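(* Let $n\ge 2$ be an integer which is not a power of $2$. Then $$\min_{T\in\Theta_n}\delta(X_T)=\delta(\tilde X_{R_n})=\nu_n .$$ The minimum is attained by $T\in\Theta_n$ if and only if the asymmetrization of $T$ is a regular pre-edge bundle $R_n$ of size $n$, and hence, if and only if $T$ is similar to a polygon $T(\alpha_1,\dots,\alpha_n)$ with $$\{\alpha_{j+1}-\alpha_j:\ j=1,\dots,n\}=\left\{c_j\exp\left(\frac{j\pi\mathbf{i}}{n}\right):\ j=0,\dots,n-1\right\}$$ for some $(c_0,\dots,c_{n-1})\in P(n)$ (with $\alpha_{n+1}=\alpha_1$).
   Context: $\Omega=\mathbb{R}/2\pi\mathbb{Z}$ carries the normalized Lebesgue (uniform probability) measure, with expectation $\mathbb{E}$; $\arg$ takes values in $(-\pi,\pi]$; $x_+=\max\{x,0\}$; indices of vertices of an $n$-gon are taken modulo $n$. For a random variable $X\ge 0$ with $\mathbb{E}(X)>0$, the deviation rate is $\delta(X)=\sqrt{\mathbb{E}(X^2)-\mathbb{E}(X)^2}/\mathbb{E}(X)$. Convex $n$-gons: $\Theta_n$ is the set of sequences $(\alpha_1,\dots,\alpha_n)$ of $n\ge2$ distinct complex numbers arranged counterclockwise as a (possibly degenerate) convex $n$-gon, i.e. such that $\arg(\alpha_2-\alpha_1)\le\arg(\alpha_3-\alpha_2)\le\cdots\le\arg(\alpha_{n+1}-\alpha_n)\le\arg(\alpha_2-\alpha_1)+2\pi$ for suitable choices of arguments modulo $2\pi$. The corresponding polygon is denoted $T=T(\alpha_1,\dots,\alpha_n)$;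 degenerate polygons are identified with the polygon on their extremal points. For nonzero $\alpha\in\mathbb{C}$ put $X_\alpha(\omega)=|\alpha|\,(\sin(\arg(\alpha)-\omega))_+$, and $X_T=\sum_{j=1}^nX_{\alpha_{j+1}-\alpha_j}$ (the length of the orthogonal shadow of $T$ under light from direction $\omega$). Pre-edge bundles: let $\mathcal{H}=\{\alpha\in\mathbb{C}: \Im\alpha>0,\text{ or }\Im\alpha=0\text{ and }\Re\alpha\ge0\}$, and $\iota(\alpha)=\alpha$ if $\alpha\in\mathcal{H}$, $\iota(\alpha)=-\alpha$ otherwise. A pre-edge bundle of size $m$ is a sequence $\mathcal{B}=\mathcal{B}(\beta_1,\dots,\beta_m)$ of nonzero elements of $\mathcal{H}$ with $0\le\arg(\beta_1)<\cdots<\arg(\beta_m)<\pi$. The asymmetrization of $T=T(\alpha_1,\dots,\alpha_n)$ is the pre-edge bundle obtained from the list $\iota(\alpha_2-\alpha_1),\dots,\iota(\alpha_{n+1}-\alpha_n)$ by replacing all elements having the same argument by their sum, and ordering by argument. For a bundle, $\tilde X_{\mathcal{B}}(\omega)=\sum_{j=1}^m\frac{|\beta_j|}{2}|\sin(\arg(\beta_j)-\omega)|$. A pre-edge bundle $\mathcal{B}(\beta_1,\dots,\beta_m)$ is regular, denoted $R_m$, if $|\beta_1|=\cdots=|\beta_m|$ and $\arg(\beta_{j+1})-\arg(\beta_j)\equiv\pi/m \pmod \pi$ for $j=1,\dots,m$ (indices modulo $m$); it is determined up to rotation and scaling, which do not affect $\delta(\tilde X_{R_m})$. Finally $$\nu_n=\sqrt{\frac{\pi}{4n\tan(\frac{\pi}{2n})}+\frac{\pi^2}{8n^2\sin^2(\frac{\pi}{2n})}-1},\qquad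 P(n)=\left\{(c_0,\dots,c_{n-1})\in\{-1,1\}^n:\ \sum_{j=0}^{n-1}c_j\exp\left(\frac{j\pi\mathbf{i}}{n}\right)=0\right\}.$$ *)

(* Defs.v *)
From HB Require Import structures.
From mathcomp Require Export all_boot all_order all_algebra.
From mathcomp Require Export all_classical all_reals all_analysis.
From mathcomp Require Export complex.

Set Implicit Arguments.
Unset Strict Implicit.
Unset Printing Implicit Defensive.

Import Order.TTheory GRing.Theory Num.Theory.

Local Open Scope classical_set_scope.
Local Open Scope ring_scope.
Local Open Scope complex_scope.

(* [complex R] carries an R[i]-valued norm; the R-valued modulus is [normc]. *)
Definition modulus {R : realType} (z : R[i]) : R := Normc.normc z.

Definition cis {R : realType} (t : R) : R[i] := cos t +i* sin t.

(* The principal argument, with values in (-pi, pi], for z != 0; the value at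
   z = 0 (namely acos 0) is meaningless. *)
Definition arg {R : realType} (z : R[i]) : R :=
  let t := acos (complex.Re z / modulus z) in
  if 0 <= complex.Im z then t else - t.

(* Random variables on R / 2 pi Z. They are represented by 2 pi-periodic
    functions R -> R, and the normalized Lebesgue measure on the circle by the
    uniform probability on the fundamental domain [0, 2 pi]. *)

Lemma lt0_2pi (R : realType) : 0 < 2 * pi :> R.
Proof. by rewrite mulr_gt0 // pi_gt0. Qed.

Definition expect {R : realType} (X : R -> R) : R :=
  fine ('E_(uniform_prob (lt0_2pi R))[X])%E.

Definition delta {R : realType} (X : R -> R) : R :=
  Num.sqrt (expect (fun w => X w ^+ 2) - expect X ^+ 2) / expect X.

Definition edge {R : realType} {n : nat} (alpha : 'I_n -> R[i]) (j : 'I_n) :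
  R[i] := alpha (ordS j) - alpha j.

Definition Theta (R : realType) (n : nat) : set ('I_n -> R[i]) :=
  [set alpha : 'I_n -> R[i] | [/\ (2 <= n)%N, injective alpha &
    exists k : 'I_n -> int,
      let theta j := arg (edge alpha j) + (k j)%:~R * (2 * pi) in
      (forall i j : 'I_n, (i <= j)%N -> theta i <= theta j) /\
      (forall i j : 'I_n, i = 0%N :> nat -> j = n.-1 :> nat ->
         theta j <= theta i + 2 * pi)]].

Arguments Theta R n : clear implicits.

(* The polygon as a subset of the plane, i.e., the convex hull of its vertices;
   hence a degenerate n-gon coincides with the polygon on its extremal points. *)
Definition polygon {R : realType} {n : nat} (alpha : 'I_n -> R[i]) :
  set R[i] :=
  [set z | exists l : 'I_n -> R,
    [/\ forall j, 0 <= l j, \sum_(j < n) l j = 1 &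
        z = \sum_(j < n) (l j)%:C * alpha j]].

Definition similar {R : realType} (A B : set R[i]) : Prop :=
  exists a b : R[i], a != 0 /\
    (B = [set a * z + b | z in A] \/ B = [set a * z^* + b | z in A]).

Definition Xseg {R : realType} (a : R[i]) (w : R) : R :=
  modulus a * Num.max (sin (arg a - w)) 0.

Definition Xpoly {R : realType} {n : nat} (alpha : 'I_n -> R[i]) (w : R) : R :=
  \sum_(j < n) Xseg (edge alpha j) w.

Definition minimizer {R : realType} {n : nat} (alpha : 'I_n -> R[i]) : Prop :=
  Theta R n alpha /\
  forall alpha' : 'I_n -> R[i],
    Theta R n alpha' -> delta (Xpoly alpha) <= delta (Xpoly alpha').

Definition halfplane {R : realType} (a : R[i]) : bool :=
  (0 < complex.Im a) || ((complex.Im a == 0) && (0 <= complex.Re a)).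

Definition iota_half {R : realType} (a : R[i]) : R[i] :=
  if halfplane a then a else - a.

Definition pre_edge_bundle {R : realType} (B : seq R[i]) : Prop :=
  [/\ forall b, b \in B -> b != 0 /\ halfplane b,
      forall b, b \in B -> 0 <= arg b < pi &
      forall i j : nat, (i < j < size B)%N -> arg B`_i < arg B`_j].

Definition asymmetrization {R : realType} {n : nat} (alpha : 'I_n -> R[i]) :
  seq R[i] :=
  let s := [seq iota_half (edge alpha j) | j <- enum 'I_n] in
  [seq \sum_(b <- s | arg b == t) b
     | t <- sort (fun x y : R => x <= y) (undup [seq arg b | b <- s])].

Definition Xbundle {R : realType} (B : seq R[i]) (w : R) : R :=
  \sum_(b <- B) modulus b / 2 * `|sin (arg b - w)|.

Definition regular_bundle {R : realType} (m : nat) (B : seq R[i]) : Prop :=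
  [/\ pre_edge_bundle B, size B = m,
      forall i j : nat, (i < m)%N -> (j < m)%N ->
        modulus B`_i = modulus B`_j &
      forall j : nat, (j < m)%N -> exists k : int,
        arg B`_(j.+1 %% m) - arg B`_j = pi / m%:R + k%:~R * pi].

Definition nu {R : realType} (n : nat) : R :=
  let t := pi / (2 * n%:R) in
  Num.sqrt (pi / (4 * n%:R * tan t)
            + pi ^+ 2 / (8 * n%:R ^+ 2 * sin t ^+ 2) - 1).

Definition Psigns (R : realType) (n : nat) : set ('I_n -> int) :=
  [set c : 'I_n -> int | (forall j, c j = -1 \/ c j = 1) /\
    \sum_(j < n) (c j)%:~R * cis (j%:R * pi / n%:R) = 0 :> R[i]].

Arguments Psigns R n : clear implicits.

(* Main.v *)
Require Import Defs.
From mathcomp Require Import measurable_realfun ring lra.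

(** The edges of a closed polygon sum to zero, so the signed lengths of its
    shadow cancel and [Xpoly] is half the sum of the [|e_j| |sin (arg e_j - w)|];
    collecting parallel edges, it is the function [Xbundle] of the
    asymmetrization. A bundle has at most [n] directions modulo [pi], and they
    cut a half turn into gaps of lengths [2 h_j]. On the gap with midpoint [mu]
    that function is a sinusoid [A cos (w - mu) + B sin (w - mu)], whence
    - [pi E(X) = \sum 2 A sin h],
    - [pi E(X^2) = \sum A^2 (h + sin h cos h) + B^2 (h - sin h cos h)]
    ([expect_shadow], [expect_shadow2]). The deviation rate depends only on the
    ratio [E(X)^2 / E(X^2)], which has to be as large as possible.

    By the Cauchy-Schwarz inequality this ratio is at most [4 / pi] times the
    sum of the [phi (h_j)], where [phi h = sin h ^ 2 / (h + sin h cos h)]: up to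
    a factor [4], [phi h] is the squared norm of the projection of the constant
    function [1] onto the sinusoids on a gap of length [2 h]. The function [phi]
    is strictly concave on [(0, pi/2]], because its derivative is an increasing
    function of the decreasing quantity [sin (2h) / (2h)] ([dphi_decreasing],
    [phi_tangent_pos]), and its tangents pass strictly above the origin
    ([phi_intercept_gt0]). As the half
    gaps add up to [pi / 2], at most [n] of them contribute at most
    [n phi (pi / (2 n))], with equality only for [n] equal gaps
    ([sum_phi_max]). This is the bound [nu n <= delta]. Equality moreover forces
    [B = 0] and a common amplitude [A] on all gaps; the lengths of the
    directions are the jumps of the derivative of [X], hence they are all
    equal and the bundle is regular ([delta_shadow_eq]). Conversely, for a
    regular bundle the sinusoids telescope to [C cos (w - mu)] on every gap
    ([delta_shadow_regular]).

    The bound is attained by a polygon as soon as the [n] unit vectors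
    [exp (i j pi / n)] can be given signs that make them sum to zero. If
    [n = d k] with [d > 1] odd, signs alternating in blocks of length [k] work,
    since multiplying the sum by [exp (i pi / d)] changes its sign
    ([alternating_sum0]). Sorting the signed vectors by direction gives the
    edges of a closed convex polygon, whose vertices are distinct because any
    proper block of consecutive edges, or its complement, lies in an open half
    plane ([partial_sums_inj]).

    Finally, [Xpoly alpha w] is the width of the polygon, as a subset of the
    plane, orthogonally to the direction [w] ([polygon_is_width]). A similarity
    therefore acts on it by a positive factor and an isometry of the circle,
    which preserve the deviation rate ([Xpoly_similar], [delta_isometry]), so that being a
    minimizer depends only on the similarity class of the polygon. *)

Set Implicit Arguments.
Unset Strict Implicit.
Unset Printing Implicit Defensive.

Import Order.TTheory GRing.Theory Num.Theory.
Import numFieldNormedType.Exports.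

Local Open Scope classical_set_scope.
Local Open Scope ring_scope.
Local Open Scope complex_scope.

(** * Expectations through antiderivatives *)

Lemma is_derive_continuous {R : realType} (f df : R -> R) (i : interval R) :
  (forall x, x \in i -> is_derive x 1 f (df x)) ->
  {within [set` i], continuous f}.
Proof.
move=> Hf; apply: derivable_within_continuous => x ix; by have [] := Hf x ix.
Qed.

(** The form in which the fundamental theorem of calculus is used throughout:
    increments of antiderivatives can be compared piece by piece, without
    splitting an integral. *)
Lemma eq_increment {R : realType} (f g F G : R -> R) (u v : R) : u <= v ->
  (forall x, u <= x <= v -> is_derive x 1 F (f x)) ->
  (forall x, u <= x <= v -> is_derive x 1 G (g x)) ->
  (forall x, u < x < v -> f x = g x) ->
  F v - F u = G v - G u.
Proof.
move=> uv dF dG fg.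
have [|x|c cuv] := @MVT_segment R (F \- G) (fun=> 0) u v uv.
- move=> x; rewrite in_itv /= => /andP[ux xv].
  have ux' : u <= x <= v by rewrite !ltW.
  have := dF x ux'; have := dG x ux' => dGx dFx.
  apply: is_derive_eq; rewrite fg ?subrr //; exact/andP.
- apply: (@is_derive_continuous R _ (fun x => f x - g x)) => y /=.
  rewrite in_itv /= => yuv.
  have := dF y yuv; have := dG y yuv => dGx dFx.
  exact: is_derive_eq.
- by rewrite mul0r /= => /eqP; rewrite subr_eq0 => /eqP H; lra.
Qed.

Lemma exists_antiderivative {R : realType} (f : R -> R) (a : R) : continuous f ->
  exists F : R -> R, forall x, a < x -> is_derive x 1 F (f x).
Proof.
move=> cf.
exists (fun y => (\int[@lebesgue_measure R]_(t in [set` `[a, y]]) (f t))%R).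
move=> x ax.
have fi : (@lebesgue_measure R).-integrable `[a, x + 1] (EFin \o f).
  apply: continuous_compact_integrable; first exact: segment_compact.
  exact: continuous_subspaceT.
have [] := @continuous_FTC1_closed R f a x (x + 1) _ fi ax (cf x).
  by rewrite ltrDl.
by move=> dF <-; rewrite derive1E; apply: DeriveDef.
Qed.

Lemma expect_antiderivative {R : realType} (f F : R -> R) : continuous f ->
  (forall x, 0 <= f x) ->
  (forall x, 0 <= x <= 2 * pi -> is_derive x 1 F (f x)) ->
  expect f = (F (2 * pi) - F 0) / (2 * pi).
Proof.
move=> cf f0 dF; rewrite /expect unlock integral_uniform; last 2 first.
- apply/measurable_EFinP; exact: continuous_measurable_fun.
- by move=> x; rewrite lee_fin.
have c01 : {within `[0, 2 * pi], continuous F}.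
  by apply: (@is_derive_continuous R _ f) => x; rewrite /= in_itv; exact: dF.
rewrite (@continuous_FTC2 R f F) //=.
- by rewrite subr0 mulrC.
- exact: lt0_2pi.
- exact: continuous_subspaceT.
- have [_ H1 H2] := (continuous_within_itvP F (lt0_2pi R)).1 c01; split => //.
  by move=> x; rewrite in_itv /= => /andP[x0 x1]; have [] := dF x; rewrite ?ltW.
- move=> x; rewrite in_itv /= => /andP[x0 x1].
  by have dFx := dF x; rewrite derive1E; apply: derive_val; apply: dFx; rewrite !ltW.
Qed.

Lemma is_derive_translate {R : realType} (F : R -> R) (df s x : R) :
  is_derive (x + s) 1 F df -> is_derive x 1 (fun y => F (y + s)) df.
Proof.
move=> dF.
have dg : is_derive x 1 (fun y => y + s) (1 : R).
  by apply: is_derive_eq; rewrite addr0.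
have := @is_derive1_comp R F (fun y => y + s) x _ _ dF dg; rewrite mulr1; exact.
Qed.

(** A period starting at the first break point replaces [[0, pi]], so that the
    pieces need not be cut at the origin. *)
Lemma expect_piecewise {R : realType} (f : R -> R) (m : nat) (t : nat -> R)
    (g G : nat -> R -> R) :
  continuous f -> (forall x, 0 <= f x) -> (forall x, f (x + pi) = f x) ->
  0 <= t 0%N -> t m = t 0%N + pi ->
  (forall j, (j < m)%N -> t j <= t j.+1) ->
  (forall j (x : R), (j < m)%N -> is_derive x 1 (G j) (g j x)) ->
  (forall j (x : R), (j < m)%N -> t j < x < t j.+1 -> f x = g j x) ->
  expect f = (\sum_(j < m) (G j (t j.+1) - G j (t j))) / pi.
Proof.
move=> cf f0 fpi t0 tm tS dG fg.
have [F dF] := @exists_antiderivative R f (-1) cf.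
have {}dF (x : R) : 0 <= x -> is_derive x 1 F (f x) by move=> x0; apply: dF; lra.
have pi0 := pi_gt0 R.
have period (x : R) : 0 <= x -> F (x + pi) - F pi = F x - F 0.
  move=> x0.
  have := @eq_increment R f f (fun y => F (y + pi)) F 0 x x0.
  rewrite add0r; apply.
  - move=> y /andP[y0 _]; apply: is_derive_translate; rewrite -fpi; apply: dF; lra.
  - by move=> y /andP[y0 _]; apply: dF.
  - by [].
have -> : expect f = (F (2 * pi) - F 0) / (2 * pi).
  by apply: expect_antiderivative => // x /andP[x0 _]; apply: dF.
have tj0 j : (j <= m)%N -> 0 <= t j.
  elim: j => [//|j IH] jm; apply: (le_trans (IH (ltnW jm))); exact: tS.
have E1 := period _ t0; have E2 := period _ (ltW pi0).
have -> : \sum_(j < m) (G j (t j.+1) - G j (t j)) = F pi - F 0.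
  transitivity (\sum_(j < m) (F (t j.+1) - F (t j))).
    apply: eq_bigr => j _; apply/esym/(@eq_increment R f (g j)).
    - exact: tS.
    - move=> x /andP[xt _]; apply: dF; apply: le_trans xt; apply: tj0; exact: ltnW.
    - by move=> x _; apply: dG.
    - by move=> x; apply: fg.
  rewrite -(big_mkord xpredT (fun j => F (t j.+1) - F (t j))) telescope_sumr // tm.
  lra.
have -> : F (2 * pi) = 2 * F pi - F 0.
  have -> : 2 * pi = pi + pi :> R by ring.
  lra.
by move: (pi : R) pi0 => p p0; field; rewrite gt_eqF.
Qed.

(** Rotations ([e = 1]) and reflections ([e = -1]) of the circle preserve its
    uniform measure. *)
Lemma expect_isometry {R : realType} (f : R -> R) (c e s : R) :
  continuous f -> (forall x, 0 <= f x) -> (forall x, f (x + 2 * pi) = f x) ->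
  0 <= c -> e = 1 \/ e = -1 ->
  expect (fun w => c * f (e * w + s)) = c * expect f.
Proof.
move=> cf f0 fp c0 e1; have q0 := lt0_2pi R.
pose a : R := - (`|s| + 2 * pi + 1).
have [F dF] := exists_antiderivative a cf.
have sa := ler_norm s; have sb := ler_norm (- s); rewrite normrN in sb.
have s0 := normr_ge0 s.
pose q : R := 2 * pi; rewrite -/q in q0 fp a dF *.
have dF2 (x : R) : a < x -> is_derive x 1 (fun y => F (y + q)) (f x).
  move=> ax; apply: is_derive_translate; rewrite -fp; apply: dF; lra.
have period (x : R) : a < x -> F (x + q) - F x = F q - F 0.
  move=> ax; have a0 : a < 0 by rewrite /a; lra.
  case: (lerP x 0) => x0.
    have := @eq_increment R f f (fun y => F (y + q)) F x 0 x0.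
    rewrite add0r => H; have : F q - F (x + q) = F 0 - F x.
      apply: H => // y /andP[xy _]; [apply: dF2; lra | apply: dF; lra].
    lra.
  have := @eq_increment R f f (fun y => F (y + q)) F 0 x (ltW x0).
  rewrite add0r => H; have : F (x + q) - F q = F x - F 0.
    apply: H => // y /andP[xy _]; [apply: dF2; lra | apply: dF; lra].
  lra.
have a0 : a < 0 by rewrite /a; lra.
have as1 : a < s by rewrite /a; lra.
have as2 : a < s - q by rewrite /a /q; lra.
have -> : expect f = (F q - F 0) / q.
  by apply: expect_antiderivative => // x /andP[x0 _]; apply: dF; lra.
have ee : e * e = 1 by case: e1 => ->; ring.
have Ecomp : expect (fun w => c * f (e * w + s)) =
    (c * e * F (e * q + s) - c * e * F (e * 0 + s)) / q.
  apply: (@expect_antiderivative R _ (fun w => c * e * F (e * w + s))).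
  - move=> x; apply: cvgMr.
    apply: (@continuous_comp _ _ _ (fun w : R => e * w + s) f); last exact: cf.
    by apply: cvgD; [apply: cvgMr; exact: cvg_id | exact: cvg_cst].
  - by move=> x; rewrite mulr_ge0.
  - move=> x /andP[x0 xq].
    have dg : is_derive x 1 (fun w : R => e * w + s) e.
      by apply: is_derive_eq; rewrite /GRing.scale /=; ring.
    have dFx : is_derive (e * x + s) 1 F (f (e * x + s)).
      by apply: dF; case: e1 => ->; rewrite /a /q; lra.
    have dc := @is_derive1_comp R F (fun w : R => e * w + s) x _ _ dFx dg.
    have -> : c * f (e * x + s) = (c * e) * (f (e * x + s) * e).
      by rewrite -[LHS]mulr1 -ee; ring.
    have dk : is_derive x 1 (fun w : R => (c * e)) 0 by exact: is_derive_cst.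
    by apply: is_derive_eq; rewrite /GRing.scale /=; ring.
rewrite Ecomp mulr0 add0r mulrA -mulrBr; congr (_ / _).
case: e1 => ->.
  by rewrite mul1r mulr1 [q + s]addrC period.
by rewrite mulN1r [- q + s]addrC -(period _ as2) subrK; ring.
Qed.

Lemma delta_isometry {R : realType} (f : R -> R) (c e s : R) :
  continuous f -> (forall x, 0 <= f x) -> (forall x, f (x + 2 * pi) = f x) ->
  0 < c -> e = 1 \/ e = -1 ->
  delta (fun w => c * f (e * w + s)) = delta f.
Proof.
move=> cf f0 fp c0 e1; rewrite /delta.
rewrite (expect_isometry s cf f0 fp (ltW c0) e1).
have -> : expect (fun w => (c * f (e * w + s)) ^+ 2) =
    c ^+ 2 * expect (fun w => f w ^+ 2).
  rewrite -(@expect_isometry R (fun w => f w ^+ 2) (c ^+ 2) e s) ?sqr_ge0 //.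
  - by congr expect; apply/funext => w; rewrite exprMn.
  - move=> x; apply: (@continuous_comp _ _ _ f (fun y : R => y ^+ 2)); first exact: cf.
    exact: exprn_continuous.
  - by move=> x; exact: sqr_ge0.
  - by move=> x; rewrite fp.
rewrite exprMn -mulrBr sqrtrM ?sqr_ge0 // sqrtr_sqr gtr0_norm //.
by rewrite -mulf_div divff ?mul1r // gt_eqF.
Qed.

(** * A strictly concave function *)

Lemma is_derive_div {R : realType} (f g : R -> R) (df dg x : R) : g x != 0 ->
  is_derive x 1 f df -> is_derive x 1 g dg ->
  is_derive x 1 (fun t => f t / g t) ((df * g x - f x * dg) / g x ^+ 2).
Proof.
move=> g0 Hf Hg; have Hv := is_deriveV g0 Hg.
apply: (@is_derive_eq _ _ _ _ _ _ _ _ (is_deriveM Hf Hv)).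
by rewrite /GRing.scale /=; field.
Qed.

(** Four times [phi h] is the squared norm of the projection of the constant
    function [1] onto the span of [cos] and [sin] in [L^2] of [[-h, h]]. *)
Definition phi {R : realType} (h : R) : R := sin h ^+ 2 / (h + sin h * cos h).

Definition dphi {R : realType} (h : R) : R :=
  2 * (h * (sin h * cos h)) / (h + sin h * cos h) ^+ 2.

Lemma sincos_gt0 {R : realType} (x : R) : 0 < x < pi / 2 -> 0 < sin x * cos x.
Proof.
move=> /andP[x0 x1]; apply: mulr_gt0; first by rewrite sin_gt0_pihalf // x0.
by apply: cos_gt0_pihalf; rewrite x1 andbT; lra.
Qed.

Lemma sincos_lt_id {R : realType} (x : R) : 0 < x <= pi / 2 -> sin x * cos x < x.
Proof.
move=> /andP[x0 x1].
have [||c] := @MVT R (fun t => sin t * cos t) (fun t => cos t ^+ 2 - sin t ^+ 2) 0 x x0.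
- move=> t _; apply: is_derive_eq.
  by rewrite /GRing.scale /=; ring.
- apply: (@is_derive_continuous R _ (fun t => cos t ^+ 2 - sin t ^+ 2)) => t _.
  by apply: is_derive_eq; rewrite /GRing.scale /=; ring.
rewrite in_itv /= => /andP[c0 cx].
rewrite sin0 mul0r subr0 => ->.
have s0 : 0 < sin c by apply: sin_gt0_pihalf; rewrite c0; lra.
have := cos2Dsin2 c; have : 0 < sin c ^+ 2 by rewrite exprn_gt0.
nra.
Qed.

(** Cross-multiplied form of the monotonicity of [sin (2t) / (2t)]. The numerator
    of its derivative is the opposite of [sin t cos t - t cos (2t)], a function
    that vanishes at [0] and has the derivative [4 t sin t cos t]. *)
Lemma sinc_decreasing {R : realType} (x y : R) : 0 < x -> x < y -> y <= pi / 2 ->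
  sin y * cos y * x < sin x * cos x * y.
Proof.
move=> x0 xy y1.
pose df (t : R) := ((cos t ^+ 2 - sin t ^+ 2) * t - sin t * cos t) / t ^+ 2.
have dfE (t : R) : 0 < t -> is_derive t 1 (fun t => sin t * cos t / t) (df t).
  move=> t0; have t0' : t != 0 by rewrite gt_eqF.
  apply: is_derive_eq; first exact: is_derive_div.
  by rewrite /df /GRing.scale /=; congr (_ / _); ring.
have [||c] := @MVT R (fun t => sin t * cos t / t) df x y xy.
- by move=> t; rewrite in_itv /= => /andP[xt _]; apply: dfE; lra.
- apply: (@is_derive_continuous R _ df) => t.
  by rewrite in_itv /= => /andP[xt _]; apply: dfE; lra.
rewrite in_itv /= => /andP[c0 cx] H.
have {}c0 : 0 < c by lra.
have [||d] := @MVT R (fun t => sin t * cos t - (cos t ^+ 2 - sin t ^+ 2) * t)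
   (fun t => 4 * (sin t * cos t) * t) 0 c c0.
- by move=> t _; apply: is_derive_eq; rewrite /GRing.scale /=; ring.
- apply: (@is_derive_continuous R _ (fun t => 4 * (sin t * cos t) * t)) => t _.
  by apply: is_derive_eq; rewrite /GRing.scale /=; ring.
rewrite in_itv /= => /andP[d0 dc]; rewrite sin0 mul0r mulr0 !subr0 => H2.
have P : 0 < 4 * (sin d * cos d) * d * c.
  have sd : 0 < sin d * cos d by apply: sincos_gt0; rewrite d0; lra.
  by apply: mulr_gt0 => //; apply: mulr_gt0 => //; apply: mulr_gt0.
have dfc : df c < 0.
  rewrite /df pmulr_llt0; first by lra.
  by rewrite invr_gt0 exprn_gt0.
have : sin y * cos y / y < sin x * cos x / x.
  by rewrite -subr_lt0 H nmulr_rlt0 ?subr_gt0.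
by rewrite ltr_pdivrMr ?(lt_trans x0) // mulrAC ltr_pdivlMr.
Qed.

Lemma phi_den_gt0 {R : realType} (x : R) : 0 < x <= pi / 2 ->
  0 < x + sin x * cos x.
Proof.
move=> /andP[x0]; rewrite le_eqVlt => /orP[/eqP->|x1].
  by rewrite cos_pihalf mulr0 addr0 divr_gt0 ?pi_gt0.
by rewrite addr_gt0 // sincos_gt0 // x0.
Qed.

Lemma is_derive_phi {R : realType} (x : R) : 0 < x <= pi / 2 ->
  is_derive x 1 phi (dphi x).
Proof.
move=> x01; have D0 : x + sin x * cos x != 0 by rewrite gt_eqF // phi_den_gt0.
have E := cos2sin2 x.
have Hn : is_derive x 1 (fun t => sin t ^+ 2) (2 * sin x * cos x).
  by apply: is_derive_eq; rewrite /GRing.scale /=; ring.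
have Hd : is_derive x 1 (fun t => t + sin t * cos t) (2 * cos x ^+ 2).
  by apply: is_derive_eq; rewrite /GRing.scale /=; ring: E.
have H := @is_derive_div R (fun t => sin t ^+ 2) (fun t => t + sin t * cos t)
  _ _ _ D0 Hn Hd.
have -> : dphi x = (2 * sin x * cos x * (x + sin x * cos x) -
    sin x ^+ 2 * (2 * cos x ^+ 2)) / (x + sin x * cos x) ^+ 2.
  by rewrite /dphi; congr (_ / _); ring.
exact: H.
Qed.

(** With [r = sin h cos h / h], the derivative of [phi] is [2 r / (1 + r) ^ 2].
    This increases with [r] on [[0, 1]], and [r] decreases with [h]. *)
Lemma dphi_decreasing {R : realType} (x y : R) : 0 < x -> x < y -> y <= pi / 2 ->
  dphi y < dphi x.
Proof.
move=> x0 xy y1; have y0 : 0 < y by lra.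
have x1 : 0 < x <= pi / 2 by rewrite x0; lra.
have y2 : 0 < y <= pi / 2 by rewrite y0; lra.
have Dx := phi_den_gt0 x1; have Dy := phi_den_gt0 y2.
have H := sinc_decreasing x0 xy y1.
have Hx := sincos_lt_id x1; have Hy := sincos_lt_id y2.
have Px : 0 < sin x * cos x by apply: sincos_gt0; rewrite x0; lra.
rewrite /dphi.
move: (sin x * cos x) (sin y * cos y) Dx Dy H Hx Hy Px => P Q Dx Dy H Hx Hy Px.
rewrite ltr_pdivrMr ?exprn_gt0 // mulrAC ltr_pdivlMr ?exprn_gt0 //.
have PQ : P * Q < x * y by nra.
rewrite -subr_gt0.
have -> : 2 * (x * P) * (y + Q) ^+ 2 - 2 * (y * Q) * (x + P) ^+ 2 =
  2 * ((P * y - Q * x) * (x * y - P * Q)) by ring.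
by rewrite mulr_gt0 // mulr_gt0 // subr_gt0.
Qed.

Lemma phi_gt0 {R : realType} (x : R) : 0 < x <= pi / 2 -> 0 < phi x.
Proof.
move=> x01; apply: divr_gt0; last exact: phi_den_gt0.
by apply: exprn_gt0; apply: sin_gt0_pi; have := pi_gt0 R; case/andP: x01 => ->; lra.
Qed.

Lemma phi_MVT {R : realType} (x y : R) : 0 < x -> x < y -> y <= pi / 2 ->
  exists2 c, x < c < y & phi y - phi x = dphi c * (y - x).
Proof.
move=> x0 xy y1.
have [||c] := @MVT R phi dphi x y xy.
- by move=> t; rewrite in_itv /= => /andP[xt ty]; apply: is_derive_phi; lra.
- apply: (@is_derive_continuous R _ dphi) => t.
  by rewrite in_itv /= => /andP[xt ty]; apply: is_derive_phi; lra.
by rewrite in_itv /= => H1 H2; exists c.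
Qed.

Lemma phi_le_id {R : realType} (x : R) : 0 < x <= pi / 2 -> phi x <= x.
Proof.
move=> x01; have Dx := phi_den_gt0 x01; case/andP: (x01) => x0 x1.
rewrite /phi ler_pdivrMr //.
have : 0 <= sin x * cos x.
  move: x1; rewrite le_eqVlt => /orP[/eqP->|x1].
    by rewrite cos_pihalf mulr0.
  by rewrite ltW // sincos_gt0 // x0.
have [|c] := @MVT R sin cos 0 x x0 (fun t _ => is_derive_sin t).
  by apply: (@is_derive_continuous R _ cos) => t _; apply: is_derive_sin.
rewrite sin0 !subr0 => _ sE; have := cos_le1 c.
have s0 : 0 < sin x by apply: sin_gt0_pi; have := pi_gt0 R; rewrite x0; lra.
move=> c1 sc; have : sin x <= x by rewrite sE; nra.
nra.
Qed.

Lemma dphi_le_half {R : realType} (x : R) : 0 < x <= pi / 2 -> dphi x <= 1 / 2.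
Proof.
move=> x01; have Dx := phi_den_gt0 x01.
rewrite /dphi ler_pdivrMr ?exprn_gt0 //.
by have := sqr_ge0 (x - sin x * cos x); nra.
Qed.

(** The slopes of [phi] are at most [1 / 2]. The mean value theorem is applied on
    [[d, x]] only, since the formula for [phi] degenerates at [0]; [phi_le_id]
    controls what is left out. *)
Lemma phi_le_half {R : realType} (x : R) : 0 < x <= pi / 2 -> phi x <= x / 2.
Proof.
move=> /andP[x0 x1]; apply/ler_addgt0Pr => e e0.
pose d := Num.min (x / 2) e.
have d0 : 0 < d by rewrite lt_min e0 andbT; lra.
have dx : d < x by rewrite gt_min; apply/orP; left; lra.
have de : d <= e by rewrite ge_min lexx orbT.
have [c /andP[dc cx] H] := phi_MVT d0 dx x1.
have cpi : 0 < c <= pi / 2 by lra.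
have := dphi_le_half cpi; have dpi : 0 < d <= pi / 2 by lra.
by have := phi_le_id dpi; nra.
Qed.

(** Strict concavity: the mean value theorem turns the monotonicity of the
    derivative into a graph lying strictly below its tangents. *)
Lemma phi_tangent_pos {R : realType} (a h : R) : 0 < a <= pi / 2 ->
  0 < h <= pi / 2 -> h != a -> phi h < phi a + dphi a * (h - a).
Proof.
move=> /andP[a0 a1] /andP[h0 h1]; rewrite neq_lt => /orP[ha|ah].
- have [c /andP[hc ca] H] := phi_MVT h0 ha a1.
  have c0 : 0 < c by lra.
  by have := dphi_decreasing c0 ca a1; nra.
- have [c /andP[ac ch] H] := phi_MVT a0 ah h1.
  have c1 : c <= pi / 2 by lra.
  by have := dphi_decreasing a0 ac c1; nra.
Qed.

(** A tangent meeting the vertical axis below the origin would be negative, hence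
    so would [phi], at the point [d] halfway to the zero of that tangent. *)
Lemma phi_intercept_ge0 {R : realType} (a : R) : 0 < a <= pi / 2 ->
  0 <= phi a - dphi a * a.
Proof.
move=> a01; rewrite leNgt; apply/negP => H.
have /andP[a0 a1] := a01.
have D0 : 0 < dphi a by rewrite -(pmulr_lgt0 _ a0); have := phi_gt0 a01; lra.
pose d := (dphi a * a - phi a) / (2 * dphi a).
have dE : dphi a * d = (dphi a * a - phi a) / 2 by rewrite /d; field; rewrite gt_eqF.
have d0 : 0 < d by apply: divr_gt0; [rewrite subr_gt0; rewrite subr_lt0 in H | lra].
have da : d < a.
  rewrite -(ltr_pM2l D0) dE; have := phi_gt0 a01; have : 0 < dphi a * a by rewrite mulr_gt0.
  lra.
have dpi : 0 < d <= pi / 2 by lra.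
have := phi_tangent_pos a01 dpi; rewrite lt_eqF // => /(_ isT).
by have := phi_gt0 dpi; rewrite mulrBr dE; lra.
Qed.

(** The weak bound at [a / 2] becomes strict at [a], by strict concavity. This is
    what makes fewer than [n] directions suboptimal. *)
Lemma phi_intercept_gt0 {R : realType} (a : R) : 0 < a <= pi / 2 ->
  0 < phi a - dphi a * a.
Proof.
move=> a01; have /andP[a0 a1] := a01.
have b01 : 0 < a / 2 <= pi / 2 by lra.
have ba : a / 2 < a by lra.
have := phi_intercept_ge0 b01.
have := phi_tangent_pos a01 b01; rewrite lt_eqF // => /(_ isT).
have b0 : 0 < a / 2 by lra.
have := dphi_decreasing b0 ba a1; nra.
Qed.

(** * Extremal distribution of the gaps *)

Section SumCore.
Variable R : realType.
Implicit Types (A B h : nat -> R) (n m : nat).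

(** [mean_sum] and [square_sum] are the integrals over a half turn of [X] and
    [X ^ 2], when [X] is [A cos u + B sin u] for [u] in [[-h, h]] on each gap. *)
Definition mean_sum m A h : R := \sum_(j < m) 2 * A j * sin (h j).

Definition square_sum m A B h : R :=
  \sum_(j < m) (A j ^+ 2 * (h j + sin (h j) * cos (h j)) +
                B j ^+ 2 * (h j - sin (h j) * cos (h j))).

(** The largest possible value of [mean_sum ^ 2 / square_sum] with [n] gaps. *)
Definition ratio_bound n : R := 4 * (n%:R * phi (pi / (2 * n%:R))).

Lemma quarter_bounds n : (0 < n)%N -> 0 < (pi : R) / (2 * n%:R) <= pi / 2.
Proof.
move=> n0; have pi0 := pi_gt0 R; have n1 : 1 <= n%:R :> R by rewrite ler1n.
have n00 : 0 < n%:R :> R by lra.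
apply/andP; split; first by rewrite divr_gt0 // mulr_gt0.
by rewrite ler_pM2l // lef_pV2 ?posrE ?mulr_gt0 //; lra.
Qed.

Lemma ratio_bound_gt0 n : (0 < n)%N -> 0 < ratio_bound n.
Proof.
move=> n0; rewrite /ratio_bound; apply: mulr_gt0 => //; apply: mulr_gt0; first by rewrite ltr0n.
by apply: phi_gt0; exact: quarter_bounds.
Qed.

Lemma phi_tangent (a x : R) : 0 < a <= pi / 2 -> 0 < x <= pi / 2 ->
  phi x <= phi a + dphi a * (x - a) ?= iff (x == a).
Proof.
move=> a1 x1; split; last first.
  case: (eqVneq x a) => [->|xa]; first by rewrite subrr mulr0 addr0 eqxx.
  by rewrite lt_eqF // phi_tangent_pos.
case: (eqVneq x a) => [->|xa]; first by rewrite subrr mulr0 addr0.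
by rewrite ltW // phi_tangent_pos.
Qed.

(** Each [phi (h j)] is bounded by the tangent at the equal distribution. The
    [n - m] missing gaps are paid for by the intercept of that tangent. *)
Lemma sum_phi_max n m h : (0 < n)%N -> (m <= n)%N ->
  (forall j, (j < m)%N -> 0 < h j <= pi / 2) -> \sum_(j < m) h j = pi / 2 ->
  4 * (\sum_(j < m) phi (h j)) <= ratio_bound n
    ?= iff (m == n) && [forall j : 'I_m, h j == pi / (2 * n%:R)].
Proof.
move=> n0 mn h1 hs; set a := pi / (2 * n%:R).
have a1 := quarter_bounds n0; rewrite -/a in a1.
have nn0 : n%:R != 0 :> R by rewrite pnatr_eq0 -lt0n.
have E : n%:R * phi a = (\sum_(j < m) (phi a + dphi a * (h j - a))) +
    (n - m)%:R * (phi a - dphi a * a).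
  have -> : \sum_(j < m) (phi a + dphi a * (h j - a)) =
     m%:R * phi a + dphi a * (pi / 2 - m%:R * a).
    rewrite big_split /= sumr_const card_ord mulr_natl; congr (_ + _).
    by rewrite -mulr_sumr big_split /= hs sumr_const card_ord mulNrn mulr_natl.
  have -> : pi / 2 = n%:R * a by rewrite /a; move: (pi : R) => p; field.
  by rewrite natrB //; ring.
have L : \sum_(j < m) phi (h j) <= \sum_(j < m) (phi a + dphi a * (h j - a))
    ?= iff [forall j : 'I_m, h j == a].
  by apply: leif_sum => j _; apply: phi_tangent => //; exact: h1.
have c0 := phi_intercept_gt0 a1.
have L2 : 0 <= (n - m)%:R * (phi a - dphi a * a) ?= iff (m == n).
  split; first by rewrite mulr_ge0 // ltW.
  by rewrite eq_sym mulf_eq0 (gt_eqF c0) orbF pnatr_eq0 subn_eq0 eqn_leq mn.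
have := leifD L L2; rewrite addr0 -E /ratio_bound -/a => L3.
split; first by rewrite ler_pM2l // L3.1.
rewrite -[_ == 4 * _]subr_eq0 -mulrBr mulf_eq0 pnatr_eq0 /= subr_eq0 L3.2.
by rewrite andbC.
Qed.

(** For [K = pi] the left-hand side is the squared [L^2] distance from [X] to the
    constant [c] over a half turn. Completing the squares isolates the distance
    from [X] to the projections of [c] onto the sinusoids of the gaps. *)
Lemma square_sum_deviation m A B h (c K : R) :
  (forall j, (j < m)%N -> 0 < h j <= pi / 2) ->
  square_sum m A B h - 2 * c * mean_sum m A h + c ^+ 2 * K =
  \sum_(j < m) ((A j - 2 * c * sin (h j) / (h j + sin (h j) * cos (h j))) ^+ 2 *
                 (h j + sin (h j) * cos (h j)) +
                B j ^+ 2 * (h j - sin (h j) * cos (h j))) +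
  c ^+ 2 * (K - 4 * (\sum_(j < m) phi (h j))).
Proof.
move=> h1.
rewrite mulrBr addrCA -addrA [in RHS]addrCA [in LHS]addrC -!addrA.
rewrite /square_sum /mean_sum.
suff -> : \sum_(j < m) (A j ^+ 2 * (h j + sin (h j) * cos (h j)) +
                B j ^+ 2 * (h j - sin (h j) * cos (h j))) =
  2 * c * (\sum_(j < m) 2 * A j * sin (h j)) - c ^+ 2 * (4 * (\sum_(j < m) phi (h j)))
  + \sum_(j < m) ((A j - 2 * c * sin (h j) / (h j + sin (h j) * cos (h j))) ^+ 2 *
                 (h j + sin (h j) * cos (h j)) +
                B j ^+ 2 * (h j - sin (h j) * cos (h j))) by ring.
rewrite !mulr_sumr -sumrB -big_split /=; apply: eq_bigr => j _.
have D := phi_den_gt0 (h1 j (ltn_ord j)).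
by rewrite /phi; field; rewrite gt_eqF.
Qed.

Lemma square_term_ge0 (x y g : R) : 0 < g <= pi / 2 ->
  0 <= x ^+ 2 * (g + sin g * cos g) + y ^+ 2 * (g - sin g * cos g).
Proof.
move=> g1; have Dp := phi_den_gt0 g1; have Dm := sincos_lt_id g1.
by rewrite addr_ge0 // mulr_ge0 ?sqr_ge0 ?subr_ge0 // ltW.
Qed.

(** With [K = ratio_bound n], the right-hand side of [square_sum_deviation] is
    nonnegative for every [c]. The best choice, which minimizes the left-hand
    side, is [c = mean_sum / ratio_bound]. *)
Lemma mean_square_le n m A B h : (0 < n)%N -> (m <= n)%N ->
  (forall j, (j < m)%N -> 0 < h j <= pi / 2) -> \sum_(j < m) h j = pi / 2 ->
  mean_sum m A h ^+ 2 <= ratio_bound n * square_sum m A B h.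
Proof.
move=> n0 mn h1 hs; have K0 := ratio_bound_gt0 n0.
pose c := mean_sum m A h / ratio_bound n.
have := @square_sum_deviation m A B h c (ratio_bound n) h1.
have -> : square_sum m A B h - 2 * c * mean_sum m A h + c ^+ 2 * ratio_bound n =
  square_sum m A B h - mean_sum m A h ^+ 2 / ratio_bound n.
  by rewrite /c; field; rewrite gt_eqF.
move=> E.
rewrite -ler_pdivrMl // mulrC -subr_ge0 E addr_ge0 //; last first.
  by rewrite mulr_ge0 ?sqr_ge0 // subr_ge0 (sum_phi_max n0 mn h1 hs).1.
apply: sumr_ge0 => j _; have hj := h1 j (ltn_ord j).
exact: square_term_ge0.
Qed.

(** In the case of equality all the squares in [square_sum_deviation] vanish. *)
Lemma mean_square_eq n m A B h : (0 < n)%N -> (m <= n)%N ->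
  (forall j, (j < m)%N -> 0 < h j <= pi / 2) -> \sum_(j < m) h j = pi / 2 ->
  0 < mean_sum m A h -> mean_sum m A h ^+ 2 = ratio_bound n * square_sum m A B h ->
  m = n /\ exists C : R, forall j, (j < m)%N ->
    [/\ h j = pi / (2 * n%:R), A j = C & B j = 0].
Proof.
move=> n0 mn h1 hs M0 ME; have K0 := ratio_bound_gt0 n0.
pose c := mean_sum m A h / ratio_bound n.
have c0 : 0 < c by rewrite divr_gt0.
have := @square_sum_deviation m A B h c (ratio_bound n) h1.
have -> : square_sum m A B h - 2 * c * mean_sum m A h + c ^+ 2 * ratio_bound n = 0.
  have -> : square_sum m A B h = mean_sum m A h ^+ 2 / ratio_bound n.
    by rewrite ME; field; rewrite gt_eqF.
  by rewrite /c; field; rewrite gt_eqF.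
move=> /esym/eqP; rewrite paddr_eq0; last 2 first.
- apply: sumr_ge0 => j _; have hj := h1 j (ltn_ord j).
  exact: square_term_ge0.
- by rewrite mulr_ge0 ?sqr_ge0 // subr_ge0 (sum_phi_max n0 mn h1 hs).1.
move=> /andP[/eqP H1]; rewrite mulf_eq0 expf_eq0 (gt_eqF c0) /= subr_eq0 eq_sym.
rewrite (sum_phi_max n0 mn h1 hs).2 => /andP[/eqP mE /forallP hE]; split => //.
set a := pi / (2 * n%:R) in hE *.
exists (2 * c * sin a / (a + sin a * cos a)) => j jm.
have hj : h j = a by apply/eqP/(hE (Ordinal jm)).
have a1 : 0 < a <= pi / 2 by rewrite -hj; exact: h1.
have D := phi_den_gt0 a1; have D' := sincos_lt_id a1.
have /eqP := H1; rewrite psumr_eq0; last first.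
  move=> i _; have hi := h1 i (ltn_ord i).
  exact: square_term_ge0.
move=> /allP /(_ (Ordinal jm) (mem_index_enum _)) /=; rewrite hj paddr_eq0; last 2 first.
- by rewrite mulr_ge0 ?sqr_ge0 // ltW.
- by rewrite mulr_ge0 ?sqr_ge0 // subr_ge0 ltW.
rewrite !mulf_eq0 !orbb subr_eq0 (gt_eqF D) subr_eq0 (gt_eqF D') !orbF.
by move=> /andP[/eqP -> /eqP ->].
Qed.

End SumCore.

(** * Sums of translates of a rectified sine *)

Section Shadow.
Variables (R : realType) (m : nat) (p t : nat -> R).

(** [Xbundle] for directions [t i] and lengths [p i], indexed by numbers. *)
Definition shadow (w : R) : R := \sum_(i < m) p i / 2 * `|sin (t i - w)|.

(** The directions cut the circle modulo [pi] at the points [t 0 < t 1 < ..],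
    and the last gap ends at [t 0 + pi]. *)
Definition knot (j : nat) : R := if (j < m)%N then t j else t 0%N + pi.

Definition halfgap (j : nat) : R := (knot j.+1 - knot j) / 2.

Definition midgap (j : nat) : R := (knot j.+1 + knot j) / 2.

(** The sign of [sin (w - t i)] for [w] in the gap starting at [t j]. *)
Definition side (i j : nat) : R := if (i <= j)%N then 1 else - 1.

(** The sinusoid with which [shadow] coincides on the gap starting at [t j]. *)
Definition wave (j : nat) (w : R) : R :=
  \sum_(i < m) side i j * (p i / 2) * sin (w - t i).

(** The coordinates of [wave j] on the cosine and the sine centred in the gap. *)
Definition amp (j : nat) : R := wave j (midgap j).

Definition skew (j : nat) : R :=
  \sum_(i < m) side i j * (p i / 2) * cos (midgap j - t i).

Hypothesis m0 : (0 < m)%N.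
Hypothesis p0 : forall i, (i < m)%N -> 0 < p i.
Hypothesis t0 : 0 <= t 0%N.
Hypothesis tlt : forall i j, (i < j < m)%N -> t i < t j.
Hypothesis tpi : forall j, (j < m)%N -> t j < pi.

Lemma t_mono (i j : nat) : (i <= j < m)%N -> t i <= t j.
Proof.
move=> /andP[]; rewrite leq_eqVlt => /orP[/eqP-> //|ij] jm.
by rewrite ltW // tlt // ij.
Qed.

Lemma knot_lt (j : nat) : (j < m)%N -> knot j < knot j.+1.
Proof.
move=> jm; rewrite /knot jm; case: ltnP => jm1; first by rewrite tlt // ltnSn.
by have := tpi jm; have := t0; move: (t 0%N) => u; lra.
Qed.

Lemma knot_le_end (j : nat) : (j <= m)%N -> knot j <= t 0%N + pi.
Proof.
rewrite leq_eqVlt /knot => /orP[/eqP->|jm]; first by rewrite ltnn.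
by rewrite jm; have := tpi jm; have := t0; move: (t 0%N) => u; lra.
Qed.

Lemma knot_ge_start (j : nat) : t 0%N <= knot j.
Proof.
rewrite /knot; case: ifP => jm; first by rewrite t_mono.
by rewrite lerDl pi_ge0.
Qed.

Lemma halfgap_bounds (j : nat) : (j < m)%N -> 0 < halfgap j <= pi / 2.
Proof.
move=> jm; have := knot_lt jm; have := @knot_le_end j.+1 jm; have := knot_ge_start j.
by rewrite /halfgap; move: (t 0%N) => u; lra.
Qed.

Lemma sum_halfgap : \sum_(j < m) halfgap j = pi / 2.
Proof.
rewrite -mulr_suml -(big_mkord xpredT (fun j => knot j.+1 - knot j)).
by rewrite telescope_sumr // /knot ltnn m0; congr (_ / _); ring.
Qed.

Lemma shadow_wave (j : nat) (w : R) : (j < m)%N -> knot j <= w <= knot j.+1 ->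
  shadow w = wave j w.
Proof.
have pi0 := pi_gt0 R; move=> jm /andP[jw wj]; apply: eq_bigr => i _.
rewrite -opprB sinN normrN /side.
have tjw : t j <= w by move: jw; rewrite /knot jm.
have wpi := le_trans wj (knot_le_end jm).
have := ltn_ord i; move: (i : nat) => k km.
have t0k : t 0%N <= t k by rewrite t_mono.
have tk := tpi km.
case: leqP => kj.
  have tkj : t k <= t j by rewrite t_mono // kj.
  rewrite mul1r ger0_norm // sin_ge0_pi //.
  by move: (t 0%N) wpi t0k => u wpi t0k; apply/andP; split; lra.
have wtk : w <= t k.
  apply: (le_trans wj); rewrite /knot (leq_ltn_trans kj km).
  by rewrite t_mono // kj.
have : 0 <= sin (t k - w).
  have t0j : t 0%N <= t j by rewrite t_mono.
  apply: sin_ge0_pi; move: (t 0%N) wpi t0k t0 t0j => u wpi t0k u0 t0j; apply/andP; split; lra.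
by rewrite -opprB sinN => H; rewrite ler0_norm; [ring | lra].
Qed.

(** Centring at the midpoint makes the two components orthogonal on the gap. *)
Lemma waveE (j : nat) (w : R) :
  wave j w = amp j * cos (w - midgap j) + skew j * sin (w - midgap j).
Proof.
rewrite /amp /skew /wave !mulr_suml -big_split /=; apply: eq_bigr => i _.
have -> : w - t i = (midgap j - t i) + (w - midgap j) by ring.
by rewrite sinD; ring.
Qed.

Lemma amp_gt0 (j : nat) : (j < m)%N -> 0 < amp j.
Proof.
have pi0 := pi_gt0 R; move=> jm; rewrite /amp -shadow_wave //; last first.
  by have := knot_lt jm; rewrite /midgap => ?; apply/andP; split; lra.
rewrite /shadow (bigD1 (Ordinal jm)) //=; apply: ltr_wpDr.
  apply: sumr_ge0 => i _; rewrite mulr_ge0 // divr_ge0 //.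
  by rewrite ltW // p0.
apply: mulr_gt0; first by rewrite divr_gt0 // p0.
have -> : t j - midgap j = - halfgap j.
  by rewrite /midgap /halfgap {2 4}/knot jm; field.
have := halfgap_bounds jm => /andP[h0 h1].
by rewrite sinN normrN gtr0_norm // sin_gt0_pi //; apply/andP; split; lra.
Qed.

Lemma shadow_ge0 (w : R) : 0 <= shadow w.
Proof.
apply: sumr_ge0 => i _; rewrite mulr_ge0 // divr_ge0 //.
by rewrite ltW // p0.
Qed.

Lemma shadow_pi (w : R) : shadow (w + pi) = shadow w.
Proof.
apply: eq_bigr => i _.
have -> : t i - w = (t i - (w + pi)) + pi by ring.
by rewrite sinDpi normrN.
Qed.

Lemma continuous_shadow : continuous shadow.
Proof.
apply: continuous_big; first exact: add_continuous.
move=> i _ x; apply: cvgMr; apply: cvg_norm; apply: continuous_cvg; first exact: continuous_sin.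
by apply: cvgB; [apply: cvg_cst | apply: cvg_id].
Qed.

Lemma sin_knotS (j : nat) : sin (knot j.+1 - midgap j) = sin (halfgap j).
Proof. by rewrite /midgap /halfgap; congr sin; field. Qed.
Lemma cos_knotS (j : nat) : cos (knot j.+1 - midgap j) = cos (halfgap j).
Proof. by rewrite /midgap /halfgap; congr cos; field. Qed.
Lemma sin_knot (j : nat) : sin (knot j - midgap j) = - sin (halfgap j).
Proof. by rewrite -sinN /midgap /halfgap; congr sin; field. Qed.
Lemma cos_knot (j : nat) : cos (knot j - midgap j) = cos (halfgap j).
Proof. by rewrite -cosN /midgap /halfgap; congr cos; field. Qed.

Lemma expect_shadow : expect shadow = mean_sum m amp halfgap / pi.
Proof.
pose G j x := amp j * sin (x - midgap j) - skew j * cos (x - midgap j).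
have dG (j : nat) (x : R) : (j < m)%N -> is_derive x 1 (G j) (wave j x).
  move=> jm; rewrite waveE /G.
  have ds : is_derive x 1 (fun y => sin (y - midgap j)) (cos (x - midgap j)).
    by apply: is_derive_translate.
  have dc : is_derive x 1 (fun y => cos (y - midgap j)) (- sin (x - midgap j)).
    by apply: is_derive_translate.
  by apply: is_derive_eq; rewrite /GRing.scale /=; ring.
rewrite (@expect_piecewise R shadow m knot wave G) //.
- congr (_ / _); apply: eq_bigr => j _.
  by rewrite /G sin_knotS cos_knotS sin_knot cos_knot; ring.
- exact: continuous_shadow.
- exact: shadow_ge0.
- exact: shadow_pi.
- by rewrite /knot m0.
- by rewrite /knot ltnn m0.
- by move=> j jm; rewrite ltW // knot_lt.
- by move=> j x jm /andP[x1 x2]; rewrite (@shadow_wave j) // !ltW.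
Qed.

Lemma expect_shadow2 :
  expect (fun w => shadow w ^+ 2) = square_sum m amp skew halfgap / pi.
Proof.
pose G j x := amp j ^+ 2 * ((x - midgap j) + sin (x - midgap j) * cos (x - midgap j)) / 2
   + skew j ^+ 2 * ((x - midgap j) - sin (x - midgap j) * cos (x - midgap j)) / 2
   + amp j * skew j * (sin (x - midgap j) * sin (x - midgap j)).
have dG (j : nat) (x : R) : (j < m)%N -> is_derive x 1 (G j) (wave j x ^+ 2).
  move=> jm; rewrite waveE /G.
  have ds : is_derive x 1 (fun y => sin (y - midgap j)) (cos (x - midgap j)).
    by apply: is_derive_translate.
  have dc : is_derive x 1 (fun y => cos (y - midgap j)) (- sin (x - midgap j)).
    by apply: is_derive_translate.
  have E := cos2sin2 (x - midgap j).
  apply: is_derive_eq; rewrite /GRing.scale /=.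
  by move: (sin _) (cos _) E => s c E; field: E.
have -> : expect (fun w => shadow w ^+ 2) =
    (\sum_(j < m) (G j (knot j.+1) - G j (knot j))) / pi.
  apply: (@expect_piecewise R _ m knot (fun j w => wave j w ^+ 2) G) => //.
  - move=> x; apply: (@continuous_comp _ _ _ shadow (fun y : R => y ^+ 2)).
      exact: continuous_shadow.
    exact: exprn_continuous.
  - by move=> x; apply: sqr_ge0.
  - by move=> x; rewrite shadow_pi.
  - by rewrite /knot m0.
  - by rewrite /knot ltnn m0.
  - by move=> j jm; rewrite ltW // knot_lt.
  - by move=> j x jm /andP[x1 x2]; rewrite (@shadow_wave j) // !ltW.
congr (_ / _); apply: eq_bigr => j _.
rewrite /G sin_knotS cos_knotS sin_knot cos_knot.
have -> : knot j.+1 - midgap j = halfgap j by rewrite /midgap /halfgap; field.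
have -> : knot j - midgap j = - halfgap j by rewrite /midgap /halfgap; field.
by field.
Qed.

Lemma mean_sum_gt0 : 0 < mean_sum m amp halfgap.
Proof.
have pi0 := pi_gt0 R; have H (j : nat) : (j < m)%N -> 0 < 2 * amp j * sin (halfgap j).
  move=> jm; have /andP[h0 h1] := halfgap_bounds jm.
  apply: mulr_gt0; first by rewrite mulr_gt0 // amp_gt0.
  by apply: sin_gt0_pi; apply/andP; split; lra.
rewrite /mean_sum (bigD1 (Ordinal m0)) //=; apply: ltr_wpDr; last exact: (H 0%N).
by apply: sumr_ge0 => j _; rewrite ltW // H.
Qed.

Lemma delta_shadow : delta shadow =
  Num.sqrt (pi * square_sum m amp skew halfgap / mean_sum m amp halfgap ^+ 2 - 1).
Proof.
rewrite /delta expect_shadow expect_shadow2.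
have := mean_sum_gt0; move: (mean_sum _ _ _) (square_sum _ _ _ _) => M S M0.
move: (pi : R) (pi_gt0 R) => q q0.
have Mq : 0 < M / q by rewrite divr_gt0.
have -> : S / q - (M / q) ^+ 2 = (M / q) ^+ 2 * (q * S / M ^+ 2 - 1).
  by field; rewrite !gt_eqF.
by rewrite sqrtrM ?sqr_ge0 // sqrtr_sqr gtr0_norm // mulrC mulKf // gt_eqF.
Qed.

Lemma nuE (n : nat) : (0 < n)%N -> nu n = Num.sqrt (pi / ratio_bound R n - 1).
Proof.
move=> n0; have a1 := quarter_bounds R n0.
have n00 : n%:R != 0 :> R by rewrite pnatr_eq0 -lt0n.
have D := phi_den_gt0 a1.
have s0 : 0 < sin (pi / (2 * n%:R)) :> R.
  by case/andP: a1 => b0 b1; apply: sin_gt0_pi; have := pi_gt0 R; rewrite b0; lra.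
rewrite /nu /ratio_bound /phi /tan; congr (Num.sqrt (_ - 1)).
have qE : pi = 2 * n%:R * (pi / (2 * n%:R)) :> R.
  by move: (pi : R) => q; field.
move: (pi / _) D a1 s0 qE => a D a1 s0 qE; rewrite !qE.
have a0 : a != 0 by rewrite gt_eqF //; case/andP: a1.
case: (eqVneq (cos a) 0) => [->|c0].
  by rewrite invr0 mulr0 !mulr0 invr0 mulr0 add0r addr0; field; rewrite n00 a0 gt_eqF.
by field; rewrite n00 c0 !gt_eqF.
Qed.

End Shadow.

(** Nonnegativity of the radicand of [nu n], without which an equality of square
    roots would not give an equality of variances. *)
Lemma ratio_bound_le_pi {R : realType} (n : nat) : (0 < n)%N -> ratio_bound R n <= pi.
Proof.
move=> n0; have a1 := quarter_bounds R n0; have := phi_le_half a1.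
have n00 : 0 < n%:R :> R by rewrite ltr0n.
have E : 4 * (n%:R * (pi / (2 * n%:R) / 2)) = pi :> R.
  by move: (pi : R) => q; field; rewrite gt_eqF.
by move=> H; rewrite -[leRHS]E /ratio_bound ler_pM2l // ler_pM2l.
Qed.

Lemma delta_shadow_ge {R : realType} (n m : nat) (p t : nat -> R) :
  (0 < m <= n)%N -> (forall i, (i < m)%N -> 0 < p i) -> 0 <= t 0%N ->
  (forall i j, (i < j < m)%N -> t i < t j) ->
  (forall j, (j < m)%N -> t j < pi) ->
  nu n <= delta (shadow m p t).
Proof.
move=> /andP[m0 mn] p0 t0 tlt tpi; have n0 := leq_trans m0 mn.
have M0 := mean_sum_gt0 m0 p0 t0 tlt tpi; have K0 := ratio_bound_gt0 R n0.
rewrite nuE // delta_shadow //; apply: ler_wsqrtr.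
rewrite lerD2r -mulrA ler_wpM2l ?pi_ge0 // ler_pdivlMr ?exprn_gt0 // mulrC.
rewrite ler_pdivrMr // mulrC; apply: mean_square_le => //.
- exact: halfgap_bounds.
- exact: sum_halfgap.
Qed.

(** The derivative of [shadow] jumps by [p j] at [t j]: neighbouring sinusoids
    differ by that multiple of a sine vanishing there. *)
Lemma wave_jump {R : realType} (m : nat) (p t : nat -> R) (j : nat) (w : R) :
  (j.+1 < m)%N -> wave m p t j.+1 w - wave m p t j w = p j.+1 * sin (w - t j.+1).
Proof.
move=> jm; rewrite /wave -sumrB (bigD1 (Ordinal jm)) //= big1 ?addr0.
  by rewrite /side leqnn ltnn; field.
move=> i /eqP ij; rewrite /side.
have -> : (i <= j.+1)%N = (i <= j)%N.
  rewrite leq_eqVlt ltnS; case: eqP => // E; case: ij; exact: val_inj.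
by rewrite subrr.
Qed.

(** Same jump across the half turn, where the sign of the sinusoid is
    reversed. *)
Lemma wave_wrap {R : realType} (m : nat) (p t : nat -> R) (w : R) :
  (0 < m)%N -> wave m p t 0 w + wave m p t m.-1 w = p 0%N * sin (w - t 0%N).
Proof.
move=> m0; rewrite /wave -big_split (bigD1 (Ordinal m0)) //= big1 ?addr0.
  by rewrite /side !leq0n; field.
move=> i /eqP i0; rewrite /side.
have -> : (i <= 0)%N = false.
  by rewrite leqn0; apply/negbTE/eqP => E; case: i0; exact: val_inj.
have -> : (i <= m.-1)%N by rewrite -ltnS prednK.
by ring.
Qed.

(** All gaps equal and all sinusoids [C cos (w - mu)]: evaluating the jump at
    [t j + pi / 2] gives the length [2 C sin (pi / (2 n))] for each [j]. *)
Lemma delta_shadow_eq {R : realType} (n m : nat) (p t : nat -> R) :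
  (0 < m <= n)%N -> (forall i, (i < m)%N -> 0 < p i) -> 0 <= t 0%N ->
  (forall i j, (i < j < m)%N -> t i < t j) ->
  (forall j, (j < m)%N -> t j < pi) ->
  delta (shadow m p t) = nu n ->
  [/\ m = n, (forall j, (j < n)%N -> knot n t j.+1 = t j + pi / n%:R) &
      exists q, forall j, (j < n)%N -> p j = q].
Proof.
move=> /andP[m0 mn] p0 t0 tlt tpi; have n0 := leq_trans m0 mn.
have M0 := mean_sum_gt0 m0 p0 t0 tlt tpi; have K0 := ratio_bound_gt0 R n0.
have hb := halfgap_bounds t0 tlt tpi; have hs := sum_halfgap t m0.
have pi0 := pi_gt0 R.
have L := mean_square_le (amp m p t) (skew m p t) n0 mn hb hs.
rewrite nuE // delta_shadow // => E.
have K1 : 0 <= pi / ratio_bound R n - 1.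
  by rewrite subr_ge0 ler_pdivlMr // mul1r ratio_bound_le_pi.
have E2 : mean_sum m (amp m p t) (halfgap m t) ^+ 2 =
    ratio_bound R n * square_sum m (amp m p t) (skew m p t) (halfgap m t).
  move: E; move: (mean_sum _ _ _) (square_sum _ _ _ _) M0 L => M S M0 L E.
  have L2 : pi / ratio_bound R n - 1 <= pi * S / M ^+ 2 - 1.
    rewrite lerD2r -mulrA ler_wpM2l ?pi_ge0 // ler_pdivlMr ?exprn_gt0 // mulrC.
    by rewrite ler_pdivrMr // mulrC.
  have := congr1 (fun x => x ^+ 2) E; rewrite !sqr_sqrtr //; last exact: le_trans L2.
  move=> /addIr; move: (pi : R) (ratio_bound R n) pi0 K0 => q K q0 K0 /eqP.
  rewrite eqr_div; last 2 first.
  - by rewrite gt_eqF // exprn_gt0.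
  - by rewrite gt_eqF.
  move=> /eqP; rewrite -mulrA.
  by move=> /(mulfI (negbT (gt_eqF q0))) <-; rewrite mulrC.
have [mnE [C HC]] := mean_square_eq n0 mn hb hs M0 E2.
subst n; clear mn.
set a := pi / (2 * m%:R) in HC.
have m00 : m%:R != 0 :> R by rewrite pnatr_eq0 -lt0n.
have bS (j : nat) : (j < m)%N -> knot m t j.+1 = t j + 2 * a.
  move=> jm; have [+ _ _] := HC j jm; rewrite /halfgap {2}/knot jm => <-.
  by field.
have waveC (j : nat) (w : R) : (j < m)%N -> wave m p t j w = C * cos (w - (t j + a)).
  move=> jm; rewrite waveE; have [hE -> ->] := HC j jm; rewrite mul0r addr0.
  by congr (_ * cos (_ - _)); rewrite /midgap bS // /knot jm; field.
split => //.
  by move=> j jm; rewrite bS //; congr (_ + _); rewrite /a; move: (pi : R) => q; field.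
exists (2 * C * sin a) => -[|j] jm.
  have := wave_wrap p t (t 0%N + pi / 2) m0.
  rewrite !waveC ?prednK //.
  have m1 : (m.-1 < m)%N by rewrite ltn_predL.
  have := bS _ m1; rewrite prednK // /knot ltnn => tE.
  have -> : t 0%N + pi / 2 - (t 0%N + a) = pi / 2 - a by ring.
  have -> : t 0%N + pi / 2 - (t m.-1 + a) = - (pi / 2 - a).
    by move: (t 0%N) (t m.-1) tE => x y tE; lra.
  have -> : t 0%N + pi / 2 - t 0%N = pi / 2 by ring.
  rewrite cosN sin_pihalf mulr1 cosB cos_pihalf sin_pihalf => <-; ring.
have := wave_jump p t (t j.+1 + pi / 2) jm.
have j1 := ltnW jm.
have := bS _ j1; rewrite /knot jm => tE.
rewrite !waveC //.
have -> : t j.+1 + pi / 2 - (t j.+1 + a) = pi / 2 - a by ring.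
have -> : t j.+1 + pi / 2 - (t j + a) = pi / 2 + a by rewrite tE; ring.
have -> : t j.+1 + pi / 2 - t j.+1 = pi / 2 by ring.
by rewrite cosB cosD sin_pihalf cos_pihalf mulr1 => <-; ring.
Qed.

Lemma sum_side_diff {R : realType} (u : nat -> R) (m j : nat) : (j < m)%N ->
  \sum_(i < m) side R i j * (u i.+1 - u i) = 2 * u j.+1 - u 0%N - u m.
Proof.
move=> jm; rewrite -(big_mkord xpredT (fun i => side R i j * (u i.+1 - u i))).
rewrite (@big_cat_nat _ _ _ j.+1) //=.
rewrite (eq_big_nat _ _ (F2 := fun i => u i.+1 - u i)); last first.
  by move=> i /andP[_ ij]; rewrite /side -ltnS ij mul1r.
rewrite [X in _ + X](eq_big_nat _ _ (F2 := fun i => - (u i.+1 - u i))); last first.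
  by move=> i /andP[ij _]; rewrite /side leqNgt ij mulN1r.
by rewrite sumrN !telescope_sumr //; ring.
Qed.

(** A sine of amplitude [q] is a difference of two cosines of amplitude
    [q / (2 sin a)], shifted by [a] to either side. For equally spaced
    directions with gaps [2 a] these cosines telescope, and only the one
    centred in the current gap remains. *)
Lemma delta_shadow_regular {R : realType} (n : nat) (p t : nat -> R) (q : R) :
  (0 < n)%N -> 0 < q -> (forall i, (i < n)%N -> p i = q) -> 0 <= t 0%N ->
  t 0%N < pi / n%:R ->
  (forall j, (j < n)%N -> t j = t 0%N + j%:R * (pi / n%:R)) ->
  delta (shadow n p t) = nu n.
Proof.
move=> n0 q0 pE t0 tn tE; have pi0 := pi_gt0 R.
have n00 : 0 < n%:R :> R by rewrite ltr0n.
have d0 : 0 < pi / n%:R :> R by rewrite divr_gt0.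
have nd : n%:R * (pi / n%:R) = pi :> R by rewrite mulrC divfK // gt_eqF.
have p0 i : (i < n)%N -> 0 < p i by move=> /pE ->.
have tlt i j : (i < j < n)%N -> t i < t j.
  move=> /andP[ij jn]; rewrite tE 1?(ltn_trans ij) // [ltRHS]tE // ltrD2l.
  by rewrite ltr_pM2r // ltr_nat.
have tpi j : (j < n)%N -> t j < pi.
  move=> jn; rewrite tE // -[ltRHS]nd.
  apply: (@lt_le_trans _ _ (j.+1%:R * (pi / n%:R))).
    have -> : j.+1%:R * (pi / n%:R) = pi / n%:R + j%:R * (pi / n%:R) :> R.
      by rewrite -[j.+1%:R]natr1; ring.
    by rewrite ltrD2r.
  by rewrite ler_pM2r // ler_nat.
rewrite nuE // delta_shadow //.
set a := pi / (2 * n%:R) : R.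
have a1 : 0 < a <= pi / 2 := quarter_bounds R n0.
have dE : pi / n%:R = 2 * a :> R.
  by rewrite /a; move: (pi : R) => r; field; rewrite gt_eqF.
have na : n%:R * (2 * a) = pi by rewrite -dE.
have s0 : 0 < sin a by case/andP: a1 => b0 b1; apply: sin_gt0_pi; apply/andP; split; lra.
have bS j : (j < n)%N -> knot n t j.+1 = t j + 2 * a.
  move=> jn; rewrite /knot; case: ltnP => jn1.
    by rewrite (tE j.+1) // (tE j) // dE -[j.+1%:R]natr1; ring.
  have nj : n = j.+1 by apply/eqP; rewrite eqn_leq jn1 jn.
  by rewrite (tE j) // dE -{1}na [in n%:R]nj -[j.+1%:R]natr1; ring.
have hE j : (j < n)%N -> halfgap n t j = a.
  by move=> jn; rewrite /halfgap bS // /knot jn; field.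
have mE j : (j < n)%N -> midgap n t j = t j + a.
  by move=> jn; rewrite /midgap bS // /knot jn; field.
pose C := q / (2 * sin a).
have waveC j w : (j < n)%N -> wave n p t j w = C * cos (w - (t j + a)).
  move=> jn; pose u i := cos (w - t 0%N - i%:R * (2 * a) + a).
  have -> : wave n p t j w = C / 2 * (\sum_(i < n) side R i j * (u i.+1 - u i)).
    rewrite /wave mulr_sumr; apply: eq_bigr => i _; rewrite pE // (tE i) // dE.
    have -> : u i.+1 = cos ((w - (t 0%N + i%:R * (2 * a))) - a).
      by rewrite /u; congr cos; rewrite -natr1; ring.
    have -> : u i = cos ((w - (t 0%N + i%:R * (2 * a))) + a).
      by rewrite /u; congr cos; ring.
    move: (w - _) => x.
    by rewrite cosB cosD /C; field; rewrite gt_eqF.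
  rewrite sum_side_diff //.
  (* half a turn later the centred cosine is reversed *)
  have -> : u n = - u 0%N.
    rewrite /u na -cosDpi.
    have -> : w - t 0%N - pi + a = w - t 0%N - 0%:R * (2 * a) + a + pi - pi *+ 2.
      by ring.
    by rewrite cosB cos2pi sin2pi; ring.
  rewrite /u (tE j) // dE.
  have -> : w - t 0%N - j.+1%:R * (2 * a) + a = w - (t 0%N + j%:R * (2 * a) + a).
    by rewrite -natr1; ring.
  by field.
have ampC j : (j < n)%N -> amp n p t j = C.
  by move=> jn; rewrite /amp waveC // mE // subrr cos0 mulr1.
have skew0 j : (j < n)%N -> skew n p t j = 0.
  move=> jn; have := waveE n p t j (midgap n t j + pi / 2).
  have -> : midgap n t j + pi / 2 - midgap n t j = pi / 2 by ring.
  rewrite cos_pihalf sin_pihalf mulr0 add0r mulr1 => <-.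
  rewrite waveC // mE //.
  have -> : t j + a + pi / 2 - (t j + a) = pi / 2 by ring.
  by rewrite cos_pihalf mulr0.
have -> : mean_sum n (amp n p t) (halfgap n t) = n%:R * (2 * C * sin a).
  rewrite /mean_sum (eq_bigr (fun=> 2 * C * sin a)); last first.
    by move=> i _; rewrite ampC // hE.
  by rewrite sumr_const card_ord -[LHS]mulr_natl.
have -> : square_sum n (amp n p t) (skew n p t) (halfgap n t) =
    n%:R * (C ^+ 2 * (a + sin a * cos a)).
  rewrite /square_sum (eq_bigr (fun=> C ^+ 2 * (a + sin a * cos a))); last first.
    by move=> i _; rewrite ampC // hE // skew0 //; ring.
  by rewrite sumr_const card_ord -[LHS]mulr_natl.
have D := phi_den_gt0 a1; have C0 : 0 < C by rewrite divr_gt0 // mulr_gt0.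
rewrite /ratio_bound -/a /phi; congr (Num.sqrt (_ - 1)).
clear waveC ampC; move: (pi : R) (sin a) (cos a) C C0 s0 D => r s c K K0 s0 D.
by field; rewrite !gt_eqF.
Qed.

(** * Arguments and heights of complex numbers *)

Lemma cos_int2pi {R : realType} (k : int) (x : R) :
  cos (x + k%:~R * (2 * pi)) = cos x.
Proof.
have H (n : nat) (y : R) : cos (y + n%:R * (2 * pi)) = cos y.
  have -> : n%:R * (2 * pi) = (pi *+ 2) *+ n :> R by rewrite !mulr_natl.
  by apply: periodicn; exact: cosD2pi.
case: k => n; first exact: H.
rewrite NegzE mulrNz mulNr.
by rewrite -[in RHS](subrK (n.+1%:R * (2 * pi)) x) H.
Qed.

Lemma sin_int2pi {R : realType} (k : int) (x : R) :
  sin (x + k%:~R * (2 * pi)) = sin x.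
Proof.
rewrite -[LHS]opprK -cosDpihalf -[RHS]opprK -cosDpihalf.
by rewrite addrAC cos_int2pi.
Qed.

(** Reduced modulo [2 pi], the difference [d] of the angles has cosine
    [1 - 2 sin ^ 2 (d / 2) = 1], while [d / 2] is in [[0, pi)]. *)
Lemma angle_eq {R : realType} (x y : R) : cos x = cos y -> sin x = sin y ->
  exists k : int, x = y + k%:~R * (2 * pi).
Proof.
move=> cE sE; have q0 := lt0_2pi R.
pose k := Num.floor ((x - y) / (2 * pi)); exists k.
pose d := x - y - k%:~R * (2 * pi).
have /andP[f0 f1] := real_floor_itv (num_real ((x - y) / (2 * pi))).
have d0 : 0 <= d.
  by rewrite subr_ge0 -ler_pdivlMr.
have d1 : d < 2 * pi.
  rewrite ltrBlDr -[X in _ < X + _]mul1r -mulrDl -ltr_pdivrMr //.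
  by rewrite [ltRHS]addrC; move: f1; rewrite intrD.
have cd : cos d = 1.
  rewrite /d -mulNr -mulrNz cos_int2pi cosB cE sE.
  by rewrite -[RHS](cos2Dsin2 y); ring.
have : sin (d / 2) ^+ 2 = 0.
  have E : cos d = cos (d / 2) ^+ 2 - sin (d / 2) ^+ 2.
    by rewrite [in LHS](_ : d = d / 2 + d / 2) ?cosD; [ring | field].
  by have := cos2Dsin2 (d / 2); rewrite cd in E; lra.
move=> /eqP; rewrite expf_eq0 /= => /eqP s0.
have : d = 0.
  apply/eqP; apply: contraT => dn0.
  have : 0 < sin (d / 2).
    by apply: sin_gt0_pi; rewrite divr_gt0 //= ?lt_neqAle 1?eq_sym ?dn0 //; lra.
  by rewrite s0 ltxx.
by move=> /eqP; rewrite /d subr_eq0 subr_eq addrC => /eqP.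
Qed.

Lemma angle_inj {R : realType} (x y : R) : - pi < x <= pi -> - pi < y <= pi ->
  cos x = cos y -> sin x = sin y -> x = y.
Proof.
move=> /andP[x0 x1] /andP[y0 y1] cE sE; have [k kE] := angle_eq cE sE.
have pi0 := pi_gt0 R.
have k1 : (k%:~R : R) < 1 by rewrite -(ltr_pM2r (lt0_2pi R)); lra.
have k0 : -1 < (k%:~R : R) by rewrite -(ltr_pM2r (lt0_2pi R)); lra.
have k00 : k = 0.
  move: k1 k0; rewrite -[1]/(1%:~R) -mulrNz !ltr_int; case: k {kE} => [[|n]|n] //.
by rewrite kE k00 mul0r addr0.
Qed.

Section Arg.
Variable R : realType.
Implicit Types (z a b : R[i]) (w t r : R).

Lemma modulusE z : modulus z = Num.sqrt (complex.Re z ^+ 2 + complex.Im z ^+ 2).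
Proof. by case: z. Qed.

Lemma modulus_ge0 z : 0 <= modulus z.
Proof. by rewrite modulusE sqrtr_ge0. Qed.

Lemma modulus_gt0 z : z != 0 -> 0 < modulus z.
Proof.
rewrite modulusE sqrtr_gt0; case: z => x y; rewrite eq_complex /= negb_and => H.
by case/orP: H => H; [apply: ltr_wpDr | apply: ltr_wpDl]; rewrite ?sqr_ge0 // exprn_even_gt0.
Qed.

Lemma modulus_polar r t : 0 <= r -> modulus ((r * cos t) +i* (r * sin t)) = r.
Proof.
move=> r0; rewrite modulusE /= !exprMn -mulrDr cos2Dsin2 mulr1.
by rewrite sqrtr_sqr ger0_norm.
Qed.

Lemma sqr_modulus z : modulus z ^+ 2 = complex.Re z ^+ 2 + complex.Im z ^+ 2.
Proof. by rewrite modulusE sqr_sqrtr // addr_ge0 // sqr_ge0. Qed.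

Lemma Re_div_modulus z : z != 0 -> -1 <= complex.Re z / modulus z <= 1.
Proof.
move=> z0; have m0 := modulus_gt0 z0.
rewrite -ler_norml normrM normfV (gtr0_norm m0) ler_pdivrMr // mul1r.
rewrite -(@ler_pXn2r _ 2) ?nnegrE // ?modulus_ge0 //.
by rewrite sqr_modulus real_normK ?num_real // lerDl sqr_ge0.
Qed.

Lemma polar_arg z : z != 0 ->
  z = (modulus z * cos (arg z)) +i* (modulus z * sin (arg z)).
Proof.
move=> z0; have m0 := modulus_gt0 z0; have H := Re_div_modulus z0.
have c : cos (arg z) = complex.Re z / modulus z.
  by rewrite /arg; case: ifP => _; rewrite ?cosN acosK // inE.
have s : sin (arg z) = complex.Im z / modulus z.
  rewrite /arg; set q := Num.sqrt (1 - (complex.Re z / modulus z) ^+ 2).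
  have qE : q = `|complex.Im z| / modulus z.
    rewrite /q expr_div_n.
    have -> : 1 - complex.Re z ^+ 2 / modulus z ^+ 2 = (complex.Im z / modulus z) ^+ 2.
      have E : complex.Im z ^+ 2 = modulus z ^+ 2 - complex.Re z ^+ 2.
        by rewrite sqr_modulus addrC addKr.
      by rewrite expr_div_n E mulrBl divff // expf_eq0 /= gt_eqF.
    by rewrite sqrtr_sqr normrM normfV (gtr0_norm m0).
  case: ifP => I0; rewrite ?sinN sin_acos // -/q qE; first by rewrite ger0_norm.
  by rewrite ltr0_norm ?ltNge ?I0 // mulNr opprK.
apply/eqP; rewrite eq_complex /= c s; apply/andP.
by split; rewrite mulrC divfK // gt_eqF.
Qed.

Lemma arg_bounds z : z != 0 -> - pi < arg z <= pi.
Proof.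
move=> z0; have m0 := modulus_gt0 z0; have H := Re_div_modulus z0.
have a0 := acos_ge0 H; have a1 := acos_lepi H; have pi0 := pi_gt0 R.
rewrite /arg; case: ifP => I0; first by apply/andP; split => //; lra.
apply/andP; split; last by lra.
rewrite ltrN2 acos_ltpi //; case/andP: H => H0 ->; rewrite andbT lt_neqAle H0 andbT.
apply/negP => /eqP/esym E.
have ReE : complex.Re z = - modulus z.
  by rewrite -(divfK (negbT (gt_eqF m0)) (complex.Re z)) E mulN1r.
have := sqr_modulus z; rewrite ReE sqrrN => /eqP.
rewrite -subr_eq0 opprD addrA subrr add0r oppr_eq0.
by rewrite expf_eq0 /= => /eqP I1; rewrite I1 lexx in I0.
Qed.

Lemma arg_polar r t : 0 < r -> - pi < t <= pi -> arg ((r * cos t) +i* (r * sin t)) = t.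
Proof.
move=> r0 t1; set z := _ +i* _.
have z0 : z != 0.
  apply/negP => /eqP zE; have := @modulus_polar r t (ltW r0).
  rewrite -/z zE modulusE /= expr0n /= addr0 sqrtr0 => rE.
  by rewrite -rE ltxx in r0.
have := polar_arg z0; have -> : modulus z = r by apply: modulus_polar; exact: ltW.
rewrite {1}/z => -[/(mulfI (negbT (gt_eqF r0))) cE /(mulfI (negbT (gt_eqF r0))) sE].
by apply/esym; apply: angle_inj => //; exact: arg_bounds.
Qed.

Lemma halfplane_arg z : z != 0 -> halfplane z = (0 <= arg z < pi).
Proof.
move=> z0; have m0 := modulus_gt0 z0; have /andP[a0 a1] := arg_bounds z0.
have pi0 := pi_gt0 R.
rewrite /halfplane [in LHS](polar_arg z0) /=.
rewrite pmulr_rgt0 // mulf_eq0 (gt_eqF m0) /= pmulr_rge0 //.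
case: (ltrgt0P (arg z)) => [ap|an|->].
- have [alt|] := ltrP (arg z) pi.
    by rewrite sin_gt0_pi // ap.
  move=> pa; have -> : arg z = pi by apply/eqP; rewrite eq_le a1.
  by rewrite sinpi cospi ltxx eqxx /=; lra.
- have sn : sin (arg z) < 0.
    by rewrite -oppr_gt0 -sinN sin_gt0_pi //; apply/andP; split; lra.
  by rewrite lt_gtF // lt_eqF.
- by rewrite sin0 cos0 ltxx eqxx /= ler01 pi0.
Qed.

(** [height z w] is the second coordinate of [z] in the frame rotated by [w],
    i.e. [Im (z exp (- i w))]. Being additive in [z], it replaces the products
    [modulus z * sin (arg z - w)]. *)
Definition height z w : R := complex.Im z * cos w - complex.Re z * sin w.

Lemma modulus_sin z w : modulus z * sin (arg z - w) = height z w.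
Proof.
have [->|z0] := eqVneq z 0.
  by rewrite modulusE /height /= expr0n /= addr0 sqrtr0 !mul0r subr0.
by rewrite {3}(polar_arg z0) /height /= sinB; ring.
Qed.

Lemma height_sum (I : Type) (s : seq I) (P : pred I) (F : I -> R[i]) w :
  height (\sum_(i <- s | P i) F i) w = \sum_(i <- s | P i) height (F i) w.
Proof.
apply: (big_morph (fun z => height z w)).
  by move=> [x1 y1] [x2 y2]; rewrite /height /=; ring.
by rewrite /height /= !mul0r subr0.
Qed.

Lemma heightN z w : height (- z) w = - height z w.
Proof. by case: z => x y; rewrite /height /=; ring. Qed.

Lemma XsegE a w : Xseg a w = (`|height a w| + height a w) / 2.
Proof.
rewrite /Xseg -modulus_sin normrM (ger0_norm (modulus_ge0 a)) -mulrDr -mulrA.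
congr (_ * _); have [s0|s0] := lerP (sin (arg a - w)) 0.
  by rewrite ler0_norm //; lra.
by rewrite gtr0_norm //; lra.
Qed.

Lemma XbundleE (B : seq R[i]) w : Xbundle B w = \sum_(b <- B) `|height b w| / 2.
Proof.
apply: eq_bigr => b _; rewrite -modulus_sin normrM (ger0_norm (modulus_ge0 b)).
by rewrite mulrAC.
Qed.

Lemma sum_edge (n : nat) (alpha : 'I_n -> R[i]) : \sum_(j < n) edge alpha j = 0.
Proof.
rewrite sumrB; apply/eqP; rewrite subr_eq0; apply/eqP.
by rewrite [RHS](reindex_inj (@ordS_inj n)).
Qed.

(** Positive parts are means of the value and its absolute value, and the
    heights of the edges add up to zero. *)
Lemma XpolyE (n : nat) (alpha : 'I_n -> R[i]) w :
  Xpoly alpha w = \sum_(j < n) `|height (edge alpha j) w| / 2.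
Proof.
rewrite /Xpoly (eq_bigr _ (fun j _ => XsegE (edge alpha j) w)) -mulr_suml big_split /=.
by rewrite -height_sum sum_edge {2}/height /= !mul0r subr0 addr0 mulr_suml.
Qed.

Lemma iota_halfP z : z != 0 -> iota_half z != 0 /\ halfplane (iota_half z).
Proof.
move=> z0; rewrite /iota_half; case: ifP => // H; split; first by rewrite oppr_eq0.
move: H z0; rewrite /halfplane eq_complex; case: z => x y /=.
move=> /negbT; rewrite !negb_or !negb_and -!leNgt -!ltNge => /andP[y0 H] H2.
rewrite oppr_gt0 oppr_eq0 oppr_ge0; move: y0; rewrite le_eqVlt => /orP[/eqP y0|-> //].
by move: H; rewrite y0 eqxx ltxx /= => /ltW.
Qed.

End Arg.

(** * Pre-edge bundles and the asymmetrization *)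

Section Bundles.
Variable R : realType.

Lemma Xbundle_shadow (B : seq R[i]) :
  Xbundle B = shadow (size B) (fun j => modulus B`_j) (fun j => arg B`_j).
Proof.
by apply/funext => w; rewrite /Xbundle /shadow (big_nth 0) big_mkord.
Qed.

Lemma bundle_shadowP (B : seq R[i]) : (0 < size B)%N -> pre_edge_bundle B ->
  [/\ forall i, (i < size B)%N -> 0 < modulus B`_i,
      0 <= arg B`_0,
      forall i j, (i < j < size B)%N -> arg B`_i < arg B`_j &
      forall j, (j < size B)%N -> arg B`_j < pi].
Proof.
move=> B0 [H1 H2 H3]; split => //.
- by move=> i iB; apply: modulus_gt0; have [] := H1 _ (mem_nth 0 iB).
- by have /andP[] := H2 _ (mem_nth 0 B0).
- by move=> i iB; have /andP[] := H2 _ (mem_nth 0 iB).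
Qed.

Lemma delta_bundle_ge (n : nat) (B : seq R[i]) :
  (0 < size B <= n)%N -> pre_edge_bundle B -> nu n <= delta (Xbundle B).
Proof.
move=> Bn HB; have /andP[B0 _] := Bn; have [p0 t0 tlt tpi] := bundle_shadowP B0 HB.
by rewrite Xbundle_shadow; exact: delta_shadow_ge.
Qed.

(** The arguments are increasing in [[0, pi)], so the multiple of [pi] that a
    regular bundle leaves free in their differences is zero, except when
    the index wraps around. *)
Lemma regular_arg (n : nat) (B : seq R[i]) (j : nat) : regular_bundle n B ->
  (j < n)%N -> arg B`_j = arg B`_0 + j%:R * (pi / n%:R).
Proof.
move=> [HB Bn _ Ha]; elim: j => [|j IH] jn; first by rewrite mul0r addr0.
have B0 : (0 < size B)%N by rewrite Bn (leq_ltn_trans _ jn).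
have [_ _ tlt tpi] := bundle_shadowP B0 HB; rewrite Bn in tlt tpi.
have pi0 := pi_gt0 R; have n00 : 0 < n%:R :> R by rewrite ltr0n (leq_ltn_trans _ jn).
have d0 : 0 < pi / n%:R :> R by rewrite divr_gt0.
have [k] := Ha j (ltnW jn); rewrite modn_small // => kE.
have t1 : arg B`_j < arg B`_j.+1 by apply: tlt; rewrite ltnSn.
have t2 : arg B`_j.+1 < pi by apply: tpi.
have jB : (j < size B)%N by rewrite Bn ltnW.
have t3 : 0 <= arg B`_j by case: HB => _ H _; case/andP: (H _ (mem_nth 0 jB)).
have dlt : pi / n%:R <= pi / 2 :> R.
  rewrite ler_pM2l // lef_pV2 ?posrE // ler_nat.
  exact: leq_trans jn.
have k1 : (k%:~R : R) < 1 by rewrite -(ltr_pM2r pi0); lra.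
have k0 : -1 < (k%:~R : R) by rewrite -(ltr_pM2r pi0); lra.
have k00 : k = 0.
  by move: k1 k0; rewrite -[1]/(1%:~R) -mulrNz !ltr_int; case: k {kE} => [[|i]|i].
have -> : arg B`_j.+1 = arg B`_j + pi / n%:R.
  by move: kE; rewrite k00 mul0r addr0 => <-; ring.
by rewrite IH 1?ltnW // -[j.+1%:R]natr1; move: (pi / _) => d; ring.
Qed.

Lemma regular_delta (n : nat) (B : seq R[i]) : (0 < n)%N ->
  regular_bundle n B -> delta (Xbundle B) = nu n.
Proof.
move=> n0 reg; have tE j := @regular_arg n B j reg; have [HB Bn Hm _] := reg.
have B0 : (0 < size B)%N by rewrite Bn.
have [p0 t0 tlt tpi] := bundle_shadowP B0 HB; rewrite Bn in p0 tpi.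
have n00 : 0 < n%:R :> R by rewrite ltr0n.
rewrite Xbundle_shadow Bn; apply: (@delta_shadow_regular R n _ _ (modulus B`_0)) => //.
- exact: p0.
- by move=> i iN; apply: Hm.
- have n1 : (n.-1 < n)%N by rewrite ltn_predL.
  have := tpi _ n1; rewrite tE //.
  have E : n%:R * (pi / n%:R) = pi :> R by rewrite mulrC divfK // gt_eqF.
  have : n%:R = n.-1%:R + 1 :> R by rewrite natr1 prednK.
  rewrite -[X in _ -> _ < X -> _]E; move: (pi / n%:R) => d -> ; lra.
Qed.

(** The last argument is followed, modulo [pi], by the first one: hence the
    shift by [-1] at the wrapping index. *)
Lemma delta_bundle_eq (n : nat) (B : seq R[i]) : (1 < n)%N ->
  (0 < size B <= n)%N -> pre_edge_bundle B -> delta (Xbundle B) = nu n ->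
  regular_bundle n B.
Proof.
move=> n1 Bn HB; have /andP[B0 _] := Bn; have [p0 t0 tlt tpi] := bundle_shadowP B0 HB.
rewrite Xbundle_shadow => /(delta_shadow_eq Bn p0 t0 tlt tpi) [mn bE [q qE]].
split => //.
- by move=> i j iN jn; rewrite (qE i) // (qE j).
- move=> j jn; move: (jn); rewrite leq_eqVlt => /orP[/eqP jE|jn1].
    exists (-1); rewrite jE modnn.
    have := bE j jn; rewrite /knot jE ltnn mulrN1z mulN1r => E.
    by rewrite -[arg B`_0](addrK pi) E; ring.
  exists 0; rewrite modn_small // mul0r addr0.
  by have := bE j jn; rewrite /knot jn1 => ->; ring.
Qed.

Lemma edge_neq0 (n : nat) (alpha : 'I_n -> R[i]) (j : 'I_n) : (1 < n)%N ->
  injective alpha -> edge alpha j != 0.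
Proof.
move=> n1 inj; rewrite /edge subr_eq0; apply/negP => /eqP /inj /(congr1 val) /=.
have := ltn_ord j; rewrite leq_eqVlt => /orP[/eqP E|H].
  by rewrite E modnn => jE; rewrite -jE in E; rewrite -E in n1.
by rewrite modn_small // => /esym/n_Sn.
Qed.

Definition halfedges (n : nat) (alpha : 'I_n -> R[i]) : seq R[i] :=
  [seq iota_half (edge alpha j) | j <- enum 'I_n].

Lemma halfedgesP (n : nat) (alpha : 'I_n -> R[i]) (b : R[i]) : (1 < n)%N ->
  injective alpha -> b \in halfedges alpha ->
  [/\ b != 0, halfplane b & 0 <= arg b < pi].
Proof.
move=> n1 inj /mapP[j _ ->].
have [b0 bh] := iota_halfP (edge_neq0 j n1 inj).
by split => //; rewrite -halfplane_arg.
Qed.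

Lemma same_arg_sum (s : seq R[i]) (t : R) :
  (forall b, b \in s -> b != 0) -> t \in [seq arg b | b <- s] -> - pi < t <= pi ->
  let z := \sum_(b <- s | arg b == t) b in
  [/\ 0 < modulus z, arg z = t &
      modulus z = \sum_(b <- s | arg b == t) modulus b].
Proof.
move=> s0 ts t1 z; pose r := \sum_(b <- s | arg b == t) modulus b.
have r0 : 0 < r.
  case/mapP: ts => b bs tE; rewrite /r (big_rem b) //= -tE eqxx.
  by apply: ltr_wpDr; [apply: sumr_ge0 => c _; exact: modulus_ge0 | apply/modulus_gt0/s0].
have zE : z = (r * cos t) +i* (r * sin t).
  rewrite /z /r !mulr_suml big_seq_cond.
  rewrite (eq_bigr (fun b => (modulus b * cos t) +i* (modulus b * sin t))); last first.
    by move=> b /andP[/s0 b0 /eqP <-]; exact: polar_arg.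
  rewrite -big_seq_cond.
  by elim/big_rec3: _ => [|b x y u _ ->].
by rewrite zE modulus_polar ?ltW // arg_polar.
Qed.

End Bundles.

Section Asymmetrization.
Variables (R : realType) (n : nat) (alpha : 'I_n -> R[i]).
Hypothesis n1 : (1 < n)%N.
Hypothesis inj : injective alpha.

Let s := halfedges alpha.

Definition directions : seq R :=
  sort (fun x y : R => x <= y) (undup [seq arg b | b <- halfedges alpha]).

Let ts := directions.

Let cls (t : R) : R[i] := \sum_(b <- s | arg b == t) b.

Lemma asymmetrizationE : asymmetrization alpha =
  [seq \sum_(b <- halfedges alpha | arg b == t) b | t <- directions].
Proof. by []. Qed.

Lemma mem_directions (t : R) : (t \in ts) = (t \in [seq arg b | b <- s]).
Proof. by rewrite /ts mem_sort mem_undup. Qed.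

Lemma directions_bounds (t : R) : t \in ts -> 0 <= t < pi.
Proof.
by rewrite mem_directions => /mapP[b bs ->]; have [] := halfedgesP n1 inj bs.
Qed.

Lemma clsP (t : R) : t \in ts ->
  [/\ 0 < modulus (cls t), arg (cls t) = t &
      modulus (cls t) = \sum_(b <- s | arg b == t) modulus b].
Proof.
move=> tts; have /andP[t0 t1] := directions_bounds tts.
apply: same_arg_sum; first by move=> b bs; have [] := halfedgesP n1 inj bs.
- by rewrite -mem_directions.
- by have pi0 := pi_gt0 R; apply/andP; split; lra.
Qed.

Lemma modulus_neq0 (z : R[i]) : 0 < modulus z -> z != 0.
Proof.
apply: contraTneq => ->.
by rewrite modulusE /= expr0n /= addr0 sqrtr0 ltxx.
Qed.

Lemma size_halfedges : size s = n.
Proof. by rewrite size_map size_enum_ord. Qed.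

Lemma size_asymmetrization : (0 < size (asymmetrization alpha) <= n)%N.
Proof.
rewrite asymmetrizationE size_map size_sort; apply/andP; split.
  rewrite lt0n size_eq0 -size_eq0 -lt0n.
  have : arg s`_0 \in undup [seq arg b | b <- s].
    by rewrite mem_undup map_f // mem_nth // size_halfedges ltnW.
  by case: (undup _).
by apply: (leq_trans (size_undup _)); rewrite size_map size_halfedges.
Qed.

Lemma asymmetrization_bundle : pre_edge_bundle (asymmetrization alpha).
Proof.
rewrite asymmetrizationE.
have H b : b \in [seq cls t | t <- ts] -> 0 <= arg b < pi /\ 0 < modulus b.
  move=> /mapP[t tts ->]; have [m0 -> _] := clsP tts; split => //.
  exact: directions_bounds.
split.
- move=> b /H [bh /modulus_neq0 b0]; split => //; by rewrite halfplane_arg.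
- by move=> b /H [].
- rewrite size_map => i j /andP[ij js].
  rewrite !(nth_map 0) ?(ltn_trans ij) //.
  have [_ -> _] := clsP (mem_nth 0 (ltn_trans ij js)).
  have [_ -> _] := clsP (mem_nth 0 js).
  have st : sorted <%R ts by rewrite /ts /directions sort_lt_sorted undup_uniq.
  by apply: (sorted_ltn_nth lt_trans) => //; rewrite inE // (ltn_trans ij).
Qed.

(** Absolute heights do not see [iota_half], and parallel vectors pointing in
    the same direction have heights of the same sign, so the absolute
    height of their sum is the sum of theirs. *)
Lemma Xpoly_asymmetrization : Xpoly alpha = Xbundle (asymmetrization alpha).
Proof.
apply/funext => w; rewrite XpolyE XbundleE asymmetrizationE big_map.
transitivity (\sum_(b <- s) `|height b w| / 2).
  rewrite /s /halfedges big_map big_enum; apply: eq_bigr => j _.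
  by rewrite /iota_half; case: ifP => // _; rewrite heightN normrN.
rewrite (perm_big _ (permEl (perm_sort _ _))) /=.
transitivity (\sum_(t <- undup [seq arg b | b <- s])
   \sum_(b <- s | arg b == t) `|height b w| / 2).
  rewrite [RHS](exchange_big_dep xpredT) //= [LHS]big_seq [RHS]big_seq; apply: eq_bigr => b bs.
  rewrite -big_filter (_ : [seq _ <- _ | _] = [:: arg b]) ?big_seq1 //.
  have u := undup_uniq [seq arg b | b <- s].
  have := filter_pred1_uniq u (_ : arg b \in undup [seq arg b | b <- s]).
  rewrite mem_undup map_f // => /(_ isT) <-.
  by apply: eq_filter => t /=; rewrite eq_sym.
rewrite big_seq [RHS]big_seq; apply: eq_bigr => t; rewrite mem_undup -mem_directions => tts.
have [m0 aE mE] := clsP tts; rewrite -/(cls t) -mulr_suml -modulus_sin aE mE; congr (_ / _).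
rewrite normrM ger0_norm ?sumr_ge0 //; last by move=> *; exact: modulus_ge0.
rewrite mulr_suml.
by apply: eq_bigr => b /eqP bt; rewrite -modulus_sin normrM bt ger0_norm // modulus_ge0.
Qed.

(** When no two edges are parallel, every class consists of one edge. *)
Lemma asymmetrization_full : size (asymmetrization alpha) = n ->
  forall k, (k < n)%N ->
  exists j : 'I_n, iota_half (edge alpha j) = (asymmetrization alpha)`_k.
Proof.
rewrite asymmetrizationE size_map => tn k kn.
have u : uniq [seq arg b | b <- s].
  apply/negPn; rewrite -ltn_size_undup size_map size_halfedges.
  by move: tn; rewrite size_sort => ->; rewrite ltnn.
rewrite (nth_map 0) ?tn //.
have : ts`_k \in ts by rewrite mem_nth // tn.
rewrite mem_directions => /mapP[b bs ->].
have [j _ jE] := mapP bs; exists j; rewrite -jE -/s.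
have := perm_to_rem bs => P.
have := perm_map arg P => P2.
move: u; rewrite (perm_uniq P2) /= => /andP[bn _].
rewrite (perm_big _ P) /= big_cons eqxx big_seq_cond big1 ?addr0 //.
by move=> c /andP[cs /eqP cE]; case/negP: bn; rewrite -cE map_f.
Qed.

End Asymmetrization.

(** * The shadow as the width of the polygon *)

Section Width.
Variable R : realType.

(** Requiring the extent to be attained determines [x] from [A] and [w]
    without a supremum, and polygons are compact. *)
Definition is_width (A : set R[i]) (w x : R) : Prop :=
  (forall z z', A z -> A z' -> height z w - height z' w <= x) /\
  (exists z z', [/\ A z, A z' & height z w - height z' w = x]).

Lemma is_width_uniq (A : set R[i]) (w x y : R) :
  is_width A w x -> is_width A w y -> x = y.
Proof.
move=> [H1 [a [b [Aa Ab E1]]]] [H2 [c [d [Ac Ad E2]]]].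
by apply/eqP; rewrite eq_le -{1}E1 -{2}E2 H1 // H2.
Qed.

Lemma sin_intpi (m : int) : sin (m%:~R * pi) = 0 :> R.
Proof.
have H (k : nat) : sin (k%:R * pi) = 0 :> R.
  elim: k => [|k IH]; first by rewrite mul0r sin0.
  by rewrite -natr1 mulrDl mul1r sinDpi IH oppr0.
case: m => k; first exact: H.
by rewrite NegzE mulrNz mulNr sinN H oppr0.
Qed.

Lemma downward_closed (n : nat) (P : pred nat) :
  (forall i j, (i <= j < n)%N -> P j -> P i) ->
  exists2 p, (p <= n)%N & forall j, (j < n)%N -> P j = (j < p)%N.
Proof.
elim: n => [|n IH] HP; first by exists 0%N.
have [|p pn Hp] := IH.
  by move=> i j /andP[ij jn]; apply: HP; rewrite ij ltnW.
case Pn : (P n).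
  exists n.+1 => // j jn; rewrite jn; apply: (HP j n) => //.
  by rewrite -ltnS jn ltnSn.
exists p; first exact: ltnW.
move=> j; rewrite ltnS leq_eqVlt => /orP[/eqP->|]; last exact: Hp.
by rewrite Pn ltnNge pn.
Qed.

Section Polygon.
Variables (n : nat) (alpha : 'I_n -> R[i]).
Hypothesis n0 : (0 < n)%N.

(** Indices taken modulo [n], so that consecutive differences are the edges,
    including the closing one. *)
Definition vertex (k : nat) : R[i] := alpha (Ordinal (ltn_pmod k n0)).

Lemma vertex_ord (j : 'I_n) : vertex j = alpha j.
Proof. by congr alpha; apply: val_inj; rewrite /= modn_small. Qed.

Lemma edge_vertex (j : 'I_n) : edge alpha j = vertex j.+1 - vertex j.
Proof.
by rewrite vertex_ord /edge; congr (alpha _ - _); apply: val_inj.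
Qed.

Lemma sum_edge_block (p q : nat) : (p <= q <= n)%N ->
  \sum_(j < n | (p <= j < q)%N) edge alpha j = vertex q - vertex p.
Proof.
move=> /andP[pq qn].
rewrite (eq_bigr (fun j : 'I_n => vertex j.+1 - vertex j)); last first.
  by move=> j _; exact: edge_vertex.
rewrite -(big_mkord (fun j => (p <= j < q)%N) (fun j => vertex j.+1 - vertex j)).
rewrite -[RHS](telescope_sumr _ pq).
rewrite (big_nat_widen p q n) // (big_nat_widenl p 0) //.
by apply: eq_bigl => j; rewrite andbC.
Qed.

(** The heights over [P] and over its complement are opposite, so twice their
    absolute value is at most the sum of all absolute heights. *)
Lemma block_le_Xpoly (P : pred 'I_n) (w : R) :
  `|\sum_(j < n | P j) height (edge alpha j) w| <= Xpoly alpha w.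
Proof.
have E : \sum_(j < n) height (edge alpha j) w = 0.
  by rewrite -height_sum sum_edge /height /= !mul0r subr0.
rewrite XpolyE -mulr_suml ler_pdivlMr //.
rewrite (bigID P) /= in E; move/eqP: E; rewrite addr_eq0 => /eqP E.
rewrite [leRHS](bigID P) /= mulrDr mulr1 [in X in X + _]E normrN addrC.
by apply: lerD; exact: ler_norm_sum.
Qed.

Lemma polygon_width_le (w : R) (z z' : R[i]) : polygon alpha z -> polygon alpha z' ->
  height z w - height z' w <= Xpoly alpha w.
Proof.
have hZ (l : R) (a : R[i]) : height (l%:C * a) w = l * height a w.
  by case: a => x y; rewrite /height /=; ring.
have V (j k : 'I_n) : height (alpha j) w - height (alpha k) w <= Xpoly alpha w.
  have hB (a b : R[i]) : height (a - b) w = height a w - height b w.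
    by case: a b => [x y] [x' y']; rewrite /height /=; ring.
  rewrite -hB -!vertex_ord; case: (leqP k j) => kj.
    rewrite -(@sum_edge_block k j) ?kj ?(ltnW (ltn_ord j)) // height_sum.
    by apply: le_trans (ler_norm _) _; exact: block_le_Xpoly.
  rewrite -[_ - _]opprB heightN -(@sum_edge_block j k) ?(ltnW kj) //; last first.
    exact: ltnW (ltn_ord k).
  rewrite height_sum.
  by apply: le_trans (ler_norm _) _; rewrite normrN; exact: block_le_Xpoly.
move=> [l [l0 l1 ->]] [l' [l'0 l'1 ->]]; rewrite !height_sum.
under eq_bigr do rewrite hZ.
under [X in _ - X]eq_bigr do rewrite hZ.
have H (k : 'I_n) : \sum_(j < n) l j * height (alpha j) w <= height (alpha k) w + Xpoly alpha w.
  rewrite -[leRHS]mul1r -l1 mulr_suml; apply: ler_sum => j _.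
  by apply: ler_wpM2l => //; rewrite -lerBlDl.
rewrite lerBlDr -[leLHS]mul1r -l'1 mulr_suml -[X in _ <= X + _]mul1r -[in X in _ <= X + _]l'1.
rewrite mulr_suml -big_split /=; apply: ler_sum => k _.
by rewrite -mulrDr addrC; apply: ler_wpM2l.
Qed.

Lemma polygon_vertex (j : 'I_n) : polygon alpha (alpha j).
Proof.
exists (fun k => (k == j)%:R); split.
- by move=> k; rewrite ler0n.
- by rewrite (bigD1 j) //= eqxx big1 ?addr0 // => k /negbTE ->.
- rewrite (bigD1 j) //= eqxx big1 ?addr0.
    by case: (alpha j) => x y; apply/eqP; rewrite eq_complex /= !mul1r !mul0r subr0 addr0 !eqxx.
  move=> k /negbTE ->.
  by case: (alpha k) => x y; apply/eqP; rewrite eq_complex /= !mul0r subr0 addr0 !eqxx.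
Qed.

(** Convexity: the edge directions turn monotonically by at most one full turn,
    so the edges whose height has a given sign form one block of consecutive
    indices, or the complement of one. The block joins two vertices that are
    extreme in direction [w]. *)
Lemma polygon_width_attained (w : R) : Theta R n alpha ->
  exists z z', [/\ polygon alpha z, polygon alpha z' &
    height z w - height z' w = Xpoly alpha w].
Proof.
move=> [n2 inj [k [mono wrap]]].
pose th (j : nat) : R := arg (edge alpha (Ordinal (ltn_pmod j n0))) +
   (k (Ordinal (ltn_pmod j n0)))%:~R * (2 * pi).
have thE (j : 'I_n) : th j = arg (edge alpha j) + (k j)%:~R * (2 * pi).
  by rewrite /th (_ : Ordinal _ = j) //; apply: val_inj; rewrite /= modn_small.
have th_mono i j : (i <= j < n)%N -> th i <= th j.
  move=> /andP[ij jn]; have iN := leq_ltn_trans ij jn.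
  by rewrite (thE (Ordinal iN)) (thE (Ordinal jn)); apply: mono.
have th_wrap j : (j < n)%N -> th j <= th 0%N + 2 * pi.
  have n1 : (n.-1 < n)%N by rewrite ltn_predL.
  move=> jn; apply: (@le_trans _ _ (th n.-1)).
    by apply: th_mono; rewrite n1 andbT -ltnS prednK.
  by rewrite (thE (Ordinal n0)) (thE (Ordinal n1)); apply: wrap.
have pi0 := pi_gt0 R.
(* [L] is the direction, equal to [w] modulo [pi], that follows [th 0]. The
   heights keep their sign while [th] runs through [[L, L + pi]], and have the
   opposite sign before and after. *)
pose m := Num.floor ((th 0%N - w) / pi) + 1.
pose L : R := w + m%:~R * pi.
have /andP[f0 f1] := real_floor_itv (num_real ((th 0%N - w) / pi)).
have L1 : th 0%N < L by move: f1; rewrite ltr_pdivrMr // -/m /L; lra.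
have L0 : L - pi <= th 0%N.
  by move: f0; rewrite ler_pdivlMr // /L /m intrD; lra.
pose e : R := cos (m%:~R * pi).
have e1 : `|e| = 1 by apply: sin0cos1; exact: sin_intpi.
have hE (j : 'I_n) : height (edge alpha j) w =
    e * (modulus (edge alpha j) * sin (th j - L)).
  rewrite -modulus_sin mulrCA; congr (_ * _).
  rewrite -(sin_int2pi (k j)) addrAC -thE.
  have -> : th j - w = (th j - L) + m%:~R * pi by rewrite /L; ring.
  by rewrite [LHS]sinD sin_intpi mulr0 addr0 mulrC.
have [|p pn pP] := @downward_closed n (fun j => th j < L).
  by move=> i j ij; apply: le_lt_trans; exact: th_mono.
have [|q qn qP] := @downward_closed n (fun j => th j <= L + pi).
  by move=> i j ij; apply: le_trans; exact: th_mono.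
have pq : (p <= q)%N.
  rewrite leqNgt; apply/negP => qp; have qn' := leq_trans qp pn.
  have := qP q qn'; have := pP q qn'; rewrite qp ltnn => tq /negbT.
  by rewrite -ltNge; lra.
have s_in (j : 'I_n) : (p <= j < q)%N -> 0 <= sin (th j - L).
  move=> /andP[pj jq]; have := pP j (ltn_ord j); have := qP j (ltn_ord j).
  rewrite jq ltnNge pj /= => h1 /negbT; rewrite -leNgt => h2.
  by apply: sin_ge0_pi; apply/andP; split; lra.
have s_out (j : 'I_n) : ~~ (p <= j < q)%N -> sin (th j - L) <= 0.
  rewrite negb_and -leqNgt -ltnNge => /orP[jp|qj].
    have := pP j (ltn_ord j); rewrite jp => h1.
    have h2 : th 0%N <= th j by apply: th_mono; rewrite ltn_ord.
    have : 0 <= sin (th j - L + pi).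
      by apply: sin_ge0_pi; apply/andP; split; move: (th 0%N) L0 L1 h2 => t0 *; lra.
    by rewrite sinDpi oppr_ge0.
  have := qP j (ltn_ord j); rewrite ltnNge qj /= => /negbT; rewrite -ltNge => h1.
  have h2 := th_wrap j (ltn_ord j).
  have : 0 <= sin (th j - L - pi).
    by apply: sin_ge0_pi; apply/andP; split; move: (th 0%N) L0 L1 h2 => t0 *; lra.
  by rewrite -oppr_le0 -sinDpi subrK.
pose S := \sum_(j < n | (p <= j < q)%N) modulus (edge alpha j) * sin (th j - L).
have XS : Xpoly alpha w = S.
  rewrite XpolyE -mulr_suml (bigID (fun j : 'I_n => (p <= j < q)%N)) /=.
  rewrite (eq_bigr (fun j : 'I_n => modulus (edge alpha j) * sin (th j - L))); last first.
    move=> j /s_in sj; rewrite hE normrM e1 mul1r ger0_norm //.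
    by rewrite mulr_ge0 // modulus_ge0.
  rewrite [X in _ + X](eq_bigr
    (fun j : 'I_n => - (modulus (edge alpha j) * sin (th j - L)))); last first.
    move=> j /s_out sj; rewrite hE normrM e1 mul1r ler0_norm //.
    by rewrite mulr_ge0_le0 // modulus_ge0.
  rewrite sumrN -/S.
  have : \sum_(j < n) height (edge alpha j) w = 0.
    by rewrite -height_sum sum_edge /height /= !mul0r subr0.
  rewrite (eq_bigr _ (fun j _ => hE j)) -mulr_sumr.
  rewrite (bigID (fun j : 'I_n => (p <= j < q)%N)) /= -/S.
  have e0 : e != 0 by rewrite -normr_eq0 e1 oner_neq0.
  by move=> /eqP; rewrite mulf_eq0 (negbTE e0) /= => /eqP; lra.
have HS : height (vertex q - vertex p) w = e * S.
  rewrite -sum_edge_block ?pq // height_sum (eq_bigr _ (fun j _ => hE j)).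
  by rewrite -mulr_sumr.
have hB : height (vertex q - vertex p) w = height (vertex q) w - height (vertex p) w.
  by case: (vertex q) (vertex p) => [x y] [x' y']; rewrite /height /=; ring.
have e2 : e = 1 \/ e = -1.
  by move/eqP: e1; rewrite eqr_norml ler01 andbT => /orP[/eqP|/eqP]; [left|right].
rewrite hB in HS; case: e2 HS => ->; rewrite ?mul1r ?mulN1r => HS.
  exists (vertex q), (vertex p); split; try exact: polygon_vertex.
  by rewrite HS XS.
exists (vertex p), (vertex q); split; try exact: polygon_vertex.
by rewrite XS; lra.
Qed.

End Polygon.

(** [Xpoly] is determined by the polygon as a set of points. *)
Lemma polygon_is_width (n : nat) (alpha : 'I_n -> R[i]) (w : R) :
  Theta R n alpha -> is_width (polygon alpha) w (Xpoly alpha w).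
Proof.
move=> H; have [n2 _ _] := H; have n0 : (0 < n)%N by rewrite ltnW.
split; last exact: polygon_width_attained.
by move=> z z'; exact: polygon_width_le.
Qed.

Lemma height_mul (a z : R[i]) (w : R) : a != 0 ->
  height (a * z) w = modulus a * height z (w - arg a).
Proof.
move=> a0; rewrite {1}(polar_arg a0); case: z => x y.
rewrite /height /= cosB sinB; ring.
Qed.

Lemma height_conj (z : R[i]) (w : R) : height z^* w = - height z (- w).
Proof. by case: z => x y; rewrite /height /= cosN sinN; ring. Qed.

Lemma is_width_affine (A : set R[i]) (a b : R[i]) (w x : R) : a != 0 ->
  is_width A (w - arg a) x -> is_width [set a * z + b | z in A] w (modulus a * x).
Proof.
move=> a0 [H1 [z1 [z2 [A1 A2 E]]]]; have m0 := modulus_gt0 a0.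
have hD (u v : R[i]) : height (u + v) w = height u w + height v w.
  by case: u v => [p q] [p' q']; rewrite /height /=; ring.
split.
  move=> _ _ [z Az <-] [z' Az' <-]; rewrite !hD !height_mul //.
  by rewrite opprD addrACA subrr addr0 -mulrBr ler_pM2l //; exact: H1.
exists (a * z1 + b), (a * z2 + b); split; [by exists z1 | by exists z2 |].
by rewrite !hD !height_mul // opprD addrACA subrr addr0 -mulrBr E.
Qed.

Lemma is_width_conj (A : set R[i]) (w x : R) :
  is_width A (- w) x -> is_width [set z^* | z in A] w x.
Proof.
move=> [H1 [z1 [z2 [A1 A2 E]]]]; split.
  move=> _ _ [z Az <-] [z' Az' <-]; rewrite !height_conj.
  by rewrite opprK addrC; exact: H1.
exists z2^*, z1^*; split; [by exists z2 | by exists z1 |].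
by rewrite !height_conj opprK addrC.
Qed.

Lemma Xpoly_similar (n m : nat) (alpha : 'I_n -> R[i]) (alpha' : 'I_m -> R[i]) :
  Theta R n alpha -> Theta R m alpha' -> similar (polygon alpha) (polygon alpha') ->
  exists c e s : R, [/\ 0 < c, e = 1 \/ e = -1 &
    Xpoly alpha' = fun w => c * Xpoly alpha (e * w + s)].
Proof.
move=> T T' [a [b [a0 H]]].
exists (modulus a).
case: H => H; [exists 1, (- arg a) | exists (-1), (arg a)]; split.
- exact: modulus_gt0.
- by left.
- apply/funext => w; apply: (is_width_uniq (polygon_is_width w T')).
  rewrite H mul1r; apply: is_width_affine => //; exact: polygon_is_width.
- exact: modulus_gt0.
- by right.
- apply/funext => w; apply: (is_width_uniq (polygon_is_width w T')).
  have -> : polygon alpha' = [set a * z + b | z in [set z^* | z in polygon alpha]].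
    by rewrite H image_comp.
  apply: is_width_affine => //; apply: is_width_conj.
  by rewrite mulN1r opprB addrC; exact: polygon_is_width.
Qed.

End Width.

(** * Polygons with prescribed edges *)

Section Existence.
Variable R : realType.

Lemma cisD (x y : R) : cis (x + y) = cis x * cis y.
Proof.
by apply/eqP; rewrite eq_complex /= cosD sinD; apply/andP; split; apply/eqP; ring.
Qed.

Lemma cisDpi (x : R) : cis (x + pi) = - cis x.
Proof. by apply/eqP; rewrite eq_complex /= cosDpi sinDpi !eqxx. Qed.

Lemma modulus_cis (t : R) : modulus (cis t) = 1.
Proof. by rewrite modulusE /= cos2Dsin2 sqrtr1. Qed.

Lemma cis_neq0 (t : R) : cis t != 0.
Proof. by apply: modulus_neq0; rewrite modulus_cis. Qed.

Lemma arg_cis (t : R) : - pi < t <= pi -> arg (cis t) = t.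
Proof. by move=> /(arg_polar ltr01); rewrite !mul1r. Qed.

Lemma polar_cis (z : R[i]) : z != 0 -> z = (modulus z)%:C * cis (arg z).
Proof.
move=> z0; rewrite {1}(polar_arg z0).
by apply/eqP; rewrite eq_complex /= !mul0r subr0 addr0 !eqxx.
Qed.

Lemma height_cis (t w : R) : height (cis t) w = sin (t - w).
Proof. by rewrite /height /= sinB; ring. Qed.

Definition unit_bundle (n : nat) : seq R[i] :=
  [seq cis (j%:R * pi / n%:R) | j <- iota 0 n].

Lemma unit_angle_bounds (n j : nat) : (j < n)%N -> 0 <= (j%:R * pi / n%:R : R) < pi.
Proof.
move=> jn; have n0 : 0 < n%:R :> R by rewrite ltr0n (leq_ltn_trans _ jn).
have pi0 := pi_gt0 R; apply/andP; split.
  by rewrite divr_ge0 ?ler0n // mulr_ge0 ?ler0n // ltW.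
by rewrite ltr_pdivrMr // mulrC ltr_pM2l // ltr_nat.
Qed.

Lemma unit_angle_arg (n j : nat) : (j < n)%N ->
  arg (cis (j%:R * pi / n%:R)) = j%:R * pi / n%:R :> R.
Proof.
move=> jn; have /andP[a b] := unit_angle_bounds jn; have pi0 := pi_gt0 R.
by apply: arg_cis; apply/andP; split; lra.
Qed.

Lemma nth_unit_bundle (n j : nat) : (j < n)%N ->
  (unit_bundle n)`_j = cis (j%:R * pi / n%:R).
Proof. by move=> jn; rewrite (nth_map 0%N) ?size_iota // nth_iota. Qed.

Lemma unit_bundle_regular (n : nat) : (1 < n)%N -> regular_bundle n (unit_bundle n).
Proof.
move=> n1; have n0 := ltnW n1; have n00 : 0 < n%:R :> R by rewrite ltr0n.
have szE : size (unit_bundle n) = n by rewrite size_map size_iota.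
split => //.
- split.
  + move=> b /mapP[j]; rewrite mem_iota add0n => /andP[_ jn] ->; split; first exact: cis_neq0.
    by rewrite halfplane_arg ?cis_neq0 // unit_angle_arg // unit_angle_bounds.
  + move=> b /mapP[j]; rewrite mem_iota add0n => /andP[_ jn] ->.
    by rewrite unit_angle_arg // unit_angle_bounds.
  + rewrite szE => i j /andP[ij jn]; have iN := ltn_trans ij jn.
    rewrite !nth_unit_bundle // !unit_angle_arg //.
    by rewrite ltr_pM2r ?invr_gt0 // ltr_pM2r ?pi_gt0 // ltr_nat.
- by move=> i j iN jn; rewrite !nth_unit_bundle // !modulus_cis.
- move=> j jn; have := jn; rewrite leq_eqVlt => /orP[/eqP jE|jn1].
    exists (-1); rewrite jE modnn !nth_unit_bundle // !unit_angle_arg //.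
    have : n%:R = j%:R + 1 :> R by rewrite natr1 jE.
    move: (pi : R) n00 => q; move: (n%:R : R) => N N0 NE.
    by rewrite mulrN1z NE; field; rewrite -NE gt_eqF.
  exists 0; rewrite modn_small // !nth_unit_bundle // !unit_angle_arg // -natr1.
  by move: (pi : R) => q; field; rewrite gt_eqF.
Qed.

(** Any monotone choice of angles for the edges will do, since it differs from the
    principal arguments by multiples of [2 pi]. *)
Lemma Theta_angles (n : nat) (alpha : 'I_n -> R[i]) (r th : 'I_n -> R) :
  (1 < n)%N -> injective alpha -> (forall j, 0 < r j) ->
  (forall j, edge alpha j = (r j)%:C * cis (th j)) ->
  (forall i j : 'I_n, (i <= j)%N -> th i <= th j) ->
  (forall i j : 'I_n, i = 0%N :> nat -> j = n.-1 :> nat -> th j <= th i + 2 * pi) ->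
  Theta R n alpha.
Proof.
move=> n1 inj r0 eE mono wrap; split => //.
have H (j : 'I_n) : exists k : int, arg (edge alpha j) + k%:~R * (2 * pi) = th j.
  have e0 := edge_neq0 j n1 inj; have m0 := modulus_gt0 e0.
  have E := polar_cis e0.
  have mE : modulus (edge alpha j) = r j.
    have -> : edge alpha j = (r j * cos (th j)) +i* (r j * sin (th j)).
      by rewrite eE; apply/eqP; rewrite eq_complex /= !mul0r subr0 addr0 !eqxx.
    by rewrite modulus_polar // ltW.
  have cE : cis (th j) = cis (arg (edge alpha j)).
    have rn : (r j)%:C != 0 by rewrite eq_complex /= eqxx andbT gt_eqF.
    by apply: (mulfI rn); rewrite -eE -mE.
  case: cE => c s; have [k kE] := angle_eq c s.
  by exists k.
have [k kE] := choice H; exists k => /=; split.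
- by move=> i j ij; rewrite !kE; exact: mono.
- by move=> i j i0 jn; rewrite !kE; exact: wrap.
Qed.

(** Unit vectors in an open half plane have a nonzero sum: their components along
    its axis [c] are positive. *)
Lemma sum_cis_neq0 (n : nat) (P : pred 'I_n) (th : 'I_n -> R) (c : R) :
  (exists j, P j) -> (forall j, P j -> - (pi / 2) < th j - c < pi / 2) ->
  \sum_(j < n | P j) cis (th j) != 0.
Proof.
move=> [j0 Pj0] H; apply/negP => /eqP E.
have : height (\sum_(j < n | P j) cis (th j)) (c - pi / 2) = 0.
  by rewrite E /height /= !mul0r subr0.
have pos j : P j -> 0 < height (cis (th j)) (c - pi / 2).
  move=> /H; rewrite height_cis => h.
  have -> : th j - (c - pi / 2) = (th j - c) + pi / 2 by ring.
  by rewrite sinDpihalf; exact: cos_gt0_pihalf.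
rewrite height_sum (bigD1 j0) //= => /eqP; rewrite gt_eqF //.
apply: ltr_wpDr; last exact: pos.
by apply: sumr_ge0 => j /andP[/pos/ltW].
Qed.

(** Two equal partial sums enclose a block of edges with zero sum; the
    complementary block then has zero sum as well. One of the two blocks spans
    less than a half turn, which is impossible by [sum_cis_neq0]. *)
Lemma partial_sums_inj (n : nat) (th : nat -> R) :
  (forall i j, (i < j < n)%N -> th i < th j) ->
  (forall i j, (i < n)%N -> (j < n)%N -> th i < th j + 2 * pi) ->
  \sum_(j < n) cis (th j) = 0 ->
  injective (fun k : 'I_n => \sum_(j < n | (j < k)%N) cis (th j)).
Proof.
move=> mono wrap tot.
have pi0 := pi_gt0 R.
have le_mono i j : (i <= j < n)%N -> th i <= th j.
  move=> /andP[]; rewrite leq_eqVlt => /orP[/eqP-> //|ij] jn.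
  by rewrite ltW // mono // ij.
suff H (a b : 'I_n) : (a < b)%N ->
    \sum_(j < n | (j < a)%N) cis (th j) <> \sum_(j < n | (j < b)%N) cis (th j).
  move=> a b /= ab; apply: val_inj; case: (ltngtP a b) => // lt.
    by case: (H a b lt).
  by case: (H b a lt).
move=> ab E.
have blk : \sum_(j < n | (a <= j < b)%N) cis (th j) = 0.
  have : \sum_(j < n | (j < b)%N) cis (th j) =
    \sum_(j < n | (j < a)%N) cis (th j) + \sum_(j < n | (a <= j < b)%N) cis (th j).
    rewrite (bigID (fun j : 'I_n => (j < a)%N)) /=; congr (_ + _); apply: eq_bigl => j.
      by case: (ltnP j a) => ja; rewrite ?andbF // (ltn_trans ja ab).
    by rewrite -leqNgt andbC.
  by rewrite E => /eqP; rewrite -{1}[X in X == _]addr0 (inj_eq (addrI _)) => /eqP <-.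
have an := ltn_ord a; have bn := ltn_ord b.
have b1 : (b.-1 < b)%N by rewrite ltn_predL (leq_ltn_trans _ ab).
have b1n := ltn_trans b1 bn.
have ab1 : (a <= b.-1)%N by rewrite -ltnS prednK // (leq_ltn_trans _ ab).
have [small|large] := ltrP (th b.-1 - th a) pi.
  have : \sum_(j < n | (a <= j < b)%N) cis (th j) != 0; last by rewrite blk eqxx.
  apply: (@sum_cis_neq0 n _ th ((th a + th b.-1) / 2)).
    by exists a; rewrite leqnn ab.
  move=> j /andP[aj jb].
  have t1 : th a <= th j by apply: le_mono; rewrite aj /=.
  have t2 : th j <= th b.-1.
    by apply: le_mono; rewrite b1n andbT -ltnS prednK // (leq_ltn_trans _ ab).
  by apply/andP; split; lra.
(* a full turn is added to the edges before [a], making the complement consecutive *)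
pose th' (j : 'I_n) : R := if (j < a)%N then th j + 2 * pi else th j.
have blk' : \sum_(j < n | ~~ (a <= j < b)%N) cis (th' j) = 0.
  rewrite (eq_bigr (fun j : 'I_n => cis (th j))); last first.
    move=> j _; rewrite /th'; case: ifP => // _.
    have := cos_int2pi 1 (th j); have := sin_int2pi 1 (th j).
    by rewrite mul1r /cis => -> ->.
  by move: tot; rewrite (bigID (fun j : 'I_n => (a <= j < b)%N)) /= blk add0r.
have : \sum_(j < n | ~~ (a <= j < b)%N) cis (th' j) != 0; last by rewrite blk' eqxx.
apply: (@sum_cis_neq0 n _ th' ((th a + th b.-1) / 2 + pi)).
  by exists b; rewrite ltnn andbF.
move=> j.
rewrite negb_and -ltnNge -leqNgt /th' => H.
case: (ltnP j a) H => [ja _|aj /= bj].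
  have t1 : th j < th a by apply: mono; rewrite ja.
  have t2 := wrap _ _ b1n (ltn_ord j).
  by apply/andP; split; lra.
have t1 : th b.-1 < th j by apply: mono; rewrite (leq_trans b1 bj) /=.
have t2 := wrap _ _ (ltn_ord j) an.
by apply/andP; split; lra.
Qed.

(** The factors are the odd part of [n] and its power of two. *)
Lemma odd_factor (n : nat) : (0 < n)%N -> ~ (exists k, n = 2 ^ k)%N ->
  exists d k, [/\ n = (d * k)%N, odd d & (1 < d)%N].
Proof.
move=> n0 np; exists (n`_(2^'))%N, (n`_2)%N; split.
- by rewrite mulnC partnC.
- by rewrite odd_2'nat part_pnat.
- rewrite ltn_neqAle part_gt0 andbT; apply/eqP => E; apply: np; exists (logn 2 n).
  by rewrite -p_part -[LHS](partnC 2%N n0) -E muln1.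
Qed.

(** Shifting by one index changes the sum by [a n - a 0 = 0]. *)
Lemma periodic_sum (a : nat -> R[i]) (n k : nat) : (forall j, a (j + n)%N = a j) ->
  \sum_(j < n) a (j + k)%N = \sum_(j < n) a j.
Proof.
move=> per; elim: k => [|k IH]; first by apply: eq_bigr => j _; rewrite addn0.
rewrite -IH; apply/eqP; rewrite -subr_eq0 -sumrB.
rewrite (eq_bigr (fun j : 'I_n => a (j.+1 + k)%N - a (j + k)%N)); last first.
  by move=> j _; rewrite addnS addSn.
rewrite -(big_mkord xpredT (fun j => a (j.+1 + k)%N - a (j + k)%N)).
by rewrite (telescope_sumr (fun j => a (j + k)%N)) // addnC per subrr.
Qed.

(** Let [a j] be the summand, for all numbers [j]. Then
    [a (j + k) = - cis (pi / d) * a j], and since [d] is odd [a] has period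
    [d * k]. Shifting by [k] therefore multiplies the sum by
    [- cis (pi / d)], which is not [1]. *)
Lemma alternating_sum0 (d k : nat) : odd d -> (1 < d)%N -> (0 < k)%N ->
  \sum_(j < d * k) (-1) ^+ (j %/ k) * cis (j%:R * pi / (d * k)%:R) = 0 :> R[i].
Proof.
move=> od d1 k0; have d0 := ltnW d1.
have dk0 : (d * k)%:R != 0 :> R by rewrite pnatr_eq0 -lt0n muln_gt0 d0.
have kk0 : k%:R != 0 :> R by rewrite pnatr_eq0 -lt0n.
have dd0 : d%:R != 0 :> R by rewrite pnatr_eq0 -lt0n.
pose a (j : nat) : R[i] := (-1) ^+ (j %/ k) * cis (j%:R * pi / (d * k)%:R).
have per j : a (j + d * k)%N = a j.
  have -> : a (j + d * k)%N = (-1) ^+ (d + j %/ k) * cis ((j + d * k)%:R * pi / (d * k)%:R).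
    by rewrite /a [in X in (X %/ _)%N]addnC divnMDl.
  rewrite /a exprD -[(-1) ^+ d]signr_odd od expr1.
  have -> : (j + d * k)%:R * pi / (d * k)%:R = j%:R * pi / (d * k)%:R + pi :> R.
    by rewrite natrD natrM; move: (pi : R) => q; field; rewrite dd0 kk0.
  by rewrite cisDpi; ring.
have step j : a (j + k)%N = - cis (pi / d%:R) * a j.
  have -> : a (j + k)%N = (-1) ^+ (1 + j %/ k) * cis ((j + k)%:R * pi / (d * k)%:R).
    by rewrite /a [in X in (X %/ _)%N]addnC -{1}[k]mul1n divnMDl.
  rewrite /a exprD expr1.
  have -> : (j + k)%:R * pi / (d * k)%:R = j%:R * pi / (d * k)%:R + pi / d%:R :> R.
    by rewrite natrD natrM; move: (pi : R) => q; field; rewrite dd0 kk0.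
  by rewrite cisD; ring.
have := periodic_sum k per; rewrite (eq_bigr _ (fun (j : 'I_(d * k)) _ => step j)) -mulr_sumr.
move=> /eqP; rewrite -subr_eq0 -[X in _ - X]mul1r -mulrBl mulf_eq0 => /orP[|/eqP //].
rewrite eq_complex /= => /andP[_]; rewrite subr0 oppr_eq0 gt_eqF // sin_gt0_pi //.
have pi0 := pi_gt0 R; rewrite divr_gt0 ?ltr0n //= ltr_pdivrMr ?ltr0n //.
by rewrite -[ltLHS]mulr1 ltr_pM2l // ltr1n.
Qed.

(** The signed vectors have distinct directions; sorted by direction, they are
    the edges of a convex polygon, which is closed because they sum to zero. *)
Lemma balanced_polygon (n : nat) (c : nat -> bool) : (1 < n)%N ->
  \sum_(j < n) (-1) ^+ c j * cis (j%:R * pi / n%:R) = 0 :> R[i] ->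
  exists alpha : 'I_n -> R[i], Theta R n alpha /\ Xpoly alpha = Xbundle (unit_bundle n).
Proof.
move=> n1 sum0; have n0 := ltnW n1; have pi0 := pi_gt0 R.
pose ang (j : nat) : R := j%:R * pi / n%:R + (c j)%:R * pi.
have cisang j : cis (ang j) = (-1) ^+ c j * cis (j%:R * pi / n%:R).
  rewrite /ang; case: (c j); last by rewrite mul0r addr0 mul1r.
  by rewrite mul1r cisDpi expr1 mulN1r.
pose s := [seq ang j | j <- iota 0 n].
pose t := sort (fun x y : R => x <= y) s.
have us : uniq s.
  rewrite map_inj_in_uniq ?iota_uniq // => i j.
  rewrite !mem_iota !add0n /= => iN jN.
  have /andP[i0 i1] := unit_angle_bounds iN; have /andP[j0 j1] := unit_angle_bounds jN.
  rewrite /ang => E.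
  have {}E : i%:R * pi / n%:R = j%:R * pi / n%:R :> R.
    by move: E; case: (c i); case: (c j); rewrite ?mul0r ?mul1r; lra.
  have n00 : n%:R^-1 != 0 :> R by rewrite invr_eq0 pnatr_eq0 -lt0n.
  move/(mulIf n00)/(mulIf (negbT (gt_eqF pi0))): E => /eqP.
  by rewrite eqr_nat => /eqP.
have st : size t = n by rewrite size_sort size_map size_iota.
have srt : sorted <%R t by rewrite sort_lt_sorted.
have tb x : x \in t -> 0 <= x < 2 * pi.
  rewrite mem_sort => /mapP[j]; rewrite mem_iota add0n /= => jn ->.
  have /andP[j0 j1] := unit_angle_bounds jn; rewrite /ang.
  by case: (c j); rewrite ?mul0r ?mul1r; apply/andP; split; lra.
pose th j := t`_j.
have thb j : (j < n)%N -> 0 <= th j < 2 * pi by move=> jn; apply/tb/mem_nth; rewrite st.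
have mono i j : (i < j < n)%N -> th i < th j.
  move=> /andP[ij jn]; apply: (sorted_ltn_nth lt_trans) => //; rewrite inE st //.
  exact: ltn_trans jn.
have wrap i j : (i < n)%N -> (j < n)%N -> th i < th j + 2 * pi.
  by move=> /thb/andP[_ i1] /thb/andP[j0 _]; lra.
have sumth (V : zmodType) (f : R -> V) : \sum_(j < n) f (th j) = \sum_(j < n) f (ang j).
  rewrite -(big_mkord xpredT (fun j => f (th j))) -{1}st -(big_nth 0 xpredT f).
  rewrite (perm_big _ (permEl (perm_sort _ _))) /= big_map.
  by rewrite -{1}[n]subn0 -/(index_iota 0 n) big_mkord.
have tot : \sum_(j < n) cis (th j) = 0.
  by rewrite sumth -[RHS]sum0; apply: eq_bigr => j _; exact: cisang.
pose alpha (k : 'I_n) := \sum_(j < n | (j < k)%N) cis (th j).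
have inj : injective alpha by apply: partial_sums_inj.
have eE (k : 'I_n) : edge alpha k = cis (th k).
  rewrite /edge /alpha /=.
  have E : \sum_(j < n | (j < k.+1)%N) cis (th j) =
      cis (th k) + \sum_(j < n | (j < k)%N) cis (th j).
    rewrite (bigD1 k) //=; congr (_ + _); apply: eq_bigl => j.
    by rewrite ltnS andbC [in RHS]ltn_neqAle.
  apply/eqP; rewrite subr_eq -E; apply/eqP.
  have := ltn_ord k; rewrite leq_eqVlt => /orP[/eqP kn|kn]; last by rewrite modn_small.
  rewrite kn modnn big_pred0 // -[LHS]tot; apply: eq_bigl => j.
  by rewrite ltn_ord.
exists alpha; split.
  apply: (@Theta_angles n alpha (fun=> 1) th) => //.
  - by move=> j; rewrite eE mul1r.
  - move=> i j; rewrite leq_eqVlt => /orP[/eqP-> //|ij].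
    by rewrite ltW // mono // ij ltn_ord.
  - by move=> i j _ _; rewrite ltW // wrap.
apply/funext => w; rewrite XpolyE XbundleE.
rewrite (eq_bigr _ (fun j _ => congr1 (fun z => `|height z w| / 2) (eE j))).
rewrite (sumth _ (fun x => `|height (cis x) w| / 2)).
rewrite /unit_bundle big_map.
have -> : iota 0 n = index_iota 0 n by rewrite /index_iota subn0.
rewrite big_mkord.
apply: eq_bigr => j _; rewrite cisang; case: (c j); last by rewrite mul1r.
by rewrite expr1 mulN1r heightN normrN.
Qed.

Lemma optimal_polygon (n : nat) : (1 < n)%N -> ~ (exists k, n = 2 ^ k)%N ->
  exists alpha : 'I_n -> R[i], Theta R n alpha /\ delta (Xpoly alpha) = nu n.
Proof.
move=> n1 np; have [d [k [nE od d1]]] := odd_factor (ltnW n1) np.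
have k0 : (0 < k)%N by rewrite lt0n; apply: contraTneq n1 => k0; rewrite nE k0 muln0.
have [|alpha [T XE]] := @balanced_polygon n (fun j => odd (j %/ k)) n1.
  rewrite -[RHS](@alternating_sum0 d k od d1 k0) -nE.
  by apply: eq_bigr => j _; rewrite signr_odd.
exists alpha; split => //; rewrite XE; apply: regular_delta; first exact: ltnW.
exact: unit_bundle_regular.
Qed.

End Existence.

Section Main.
Variable R : realType.

(** The [n] vectors on the right are pairwise non-parallel, hence distinct, so
    the [n] edges exhaust them without repetition. *)
Lemma sign_edges_Xpoly (n : nat) (c : 'I_n -> int) (alpha : 'I_n -> R[i]) :
  (forall j, c j = -1 \/ c j = 1) ->
  [set edge alpha j | j in [set: 'I_n]] =
  [set (c j)%:~R * cis (j%:R * pi / n%:R) | j in [set: 'I_n]] ->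
  Xpoly alpha = Xbundle (unit_bundle R n).
Proof.
move=> c1 E; apply/funext => w.
have H (k : 'I_n) : exists j, edge alpha j = (c k)%:~R * cis (k%:R * pi / n%:R).
  have : [set edge alpha j | j in [set: 'I_n]] ((c k)%:~R * cis (k%:R * pi / n%:R)).
    by rewrite E; exists k.
  by case=> j _ jE; exists j.
have [f fE] := choice H.
have hc (k : 'I_n) (x : R) : `|height ((c k)%:~R * cis (k%:R * pi / n%:R)) x| =
    `|height (cis (k%:R * pi / n%:R)) x|.
  by case: (c1 k) => ->; rewrite ?mulrN1z ?mulr1z ?mulN1r ?mul1r // heightN normrN.
have finj : injective f.
  move=> k l kl; have := fE k; rewrite kl fE.
  move=> /esym /(congr1 (fun z => `|height z (l%:R * pi / n%:R)|)).
  rewrite !hc !height_cis subrr sin0 normr0 => /eqP; rewrite normr_eq0 => /eqP s0.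
  have pi0 := pi_gt0 R.
  have /andP[k0 k1] := unit_angle_bounds R (ltn_ord k).
  have /andP[l0 l1] := unit_angle_bounds R (ltn_ord l).
  have : k%:R * pi / n%:R = l%:R * pi / n%:R :> R.
    case: (ltrgtP (k%:R * pi / n%:R : R) (l%:R * pi / n%:R)) => // lt.
      have : 0 < sin (l%:R * pi / n%:R - k%:R * pi / n%:R) :> R.
        by apply: sin_gt0_pi; apply/andP; split; lra.
      by rewrite -opprB sinN s0 oppr0 ltxx.
    have : 0 < sin (k%:R * pi / n%:R - l%:R * pi / n%:R) :> R.
      by apply: sin_gt0_pi; apply/andP; split; lra.
    by rewrite s0 ltxx.
  have n00 : n%:R^-1 != 0 :> R.
    by rewrite invr_eq0 pnatr_eq0 -lt0n (leq_ltn_trans _ (ltn_ord k)).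
  move/(mulIf n00)/(mulIf (negbT (gt_eqF pi0))) => /eqP.
  by rewrite eqr_nat => /eqP /val_inj.
rewrite XpolyE XbundleE (reindex_inj finj) /=.
rewrite /unit_bundle big_map.
have -> : iota 0 n = index_iota 0 n by rewrite /index_iota subn0.
by rewrite big_mkord; apply: eq_bigr => j _; rewrite fE hc.
Qed.

Lemma Theta_scale (n : nat) (alpha : 'I_n -> R[i]) (r t : R) : 0 < r ->
  Theta R n alpha -> Theta R n (fun j => r%:C * cis t * alpha j).
Proof.
move=> r0 [n1 inj [k [mono wrap]]].
have u0 : r%:C * cis t != 0.
  by rewrite mulf_neq0 ?cis_neq0 // eq_complex /= eqxx andbT gt_eqF.
apply: (@Theta_angles R n _ (fun j => r * modulus (edge alpha j))
   (fun j => t + (arg (edge alpha j) + (k j)%:~R * (2 * pi)))) => //.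
- by move=> i j /(mulfI u0) /inj.
- by move=> j; rewrite mulr_gt0 // modulus_gt0 // edge_neq0.
- move=> j; rewrite /edge -mulrBr -/(edge alpha j).
  have -> : cis (t + (arg (edge alpha j) + (k j)%:~R * (2 * pi))) =
      cis t * cis (arg (edge alpha j)).
    by rewrite addrA [LHS]/cis cos_int2pi sin_int2pi -/(cis _) cisD.
  rewrite {1}(polar_cis (edge_neq0 j n1 inj)) rmorphM /=; ring.
- by move=> i j ij; rewrite lerD2l; exact: mono.
- by move=> i j i0 jn; rewrite -addrA lerD2l; exact: wrap.
Qed.

Lemma polygon_scale (n : nat) (alpha : 'I_n -> R[i]) (u : R[i]) : u != 0 ->
  similar (polygon alpha) (polygon (fun j => u * alpha j)).
Proof.
move=> u0; exists u, 0; split => //; left; apply/seteqP; split => z.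
  move=> [l [l0 l1 ->]]; exists (\sum_(j < n) (l j)%:C * alpha j); first by exists l.
  rewrite addr0 mulr_sumr; apply: eq_bigr => j _; ring.
move=> [_ [l [l0 l1 ->]] <-]; exists l; split => //.
by rewrite addr0 mulr_sumr; apply: eq_bigr => j _; ring.
Qed.

(** A regular asymmetrization has [n] elements, so each of them comes from exactly
    one edge, up to sign. Rotating and scaling its first element to [1] moves
    its elements to the [exp (i j pi / n)]. *)
Lemma regular_sign_edges (n : nat) (alpha : 'I_n -> R[i]) :
  Theta R n alpha -> regular_bundle n (asymmetrization alpha) ->
  exists (c : 'I_n -> int) (alpha' : 'I_n -> R[i]),
    [/\ Psigns R n c, Theta R n alpha',
        [set edge alpha' j | j in [set: 'I_n]] =
        [set (c j)%:~R * cis (j%:R * pi / n%:R) | j in [set: 'I_n]] &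
        similar (polygon alpha) (polygon alpha')].
Proof.
move=> T reg; have [n1 inj _] := T; have n0 : (0 < n)%N := ltnW n1.
set B := asymmetrization alpha in reg *.
have [HB Bn Hm _] := reg.
have B0 : (0 < size B)%N by rewrite Bn.
have [p0 _ _ _] := bundle_shadowP B0 HB; rewrite Bn in p0.
have r0 : 0 < modulus B`_0 by apply: p0.
pose u : R[i] := (modulus B`_0)^-1%:C * cis (- arg B`_0).
have u0 : u != 0.
  by rewrite mulf_neq0 ?cis_neq0 // eq_complex /= eqxx andbT invr_eq0 gt_eqF.
have uB (k : 'I_n) : u * B`_k = cis (k%:R * pi / n%:R).
  have b0 : B`_k != 0 by apply: modulus_neq0; exact: p0.
  rewrite (polar_cis b0) (Hm k 0%N) // (regular_arg reg) // cisD /u.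
  have -> : k%:R * (pi / n%:R) = k%:R * pi / n%:R :> R by rewrite mulrA.
  transitivity (((modulus B`_0)^-1%:C * (modulus B`_0)%:C) *
     (cis (- arg B`_0) * cis (arg B`_0)) * cis (k%:R * pi / n%:R)); first by ring.
  rewrite -cisD addNr -rmorphM /= mulVf ?gt_eqF //.
  by rewrite /cis cos0 sin0 !mul1r.
have [f fE] := choice (fun k : 'I_n => asymmetrization_full Bn (ltn_ord k)).
rewrite -/B in fE.
pose c (k : 'I_n) : int := if halfplane (edge alpha (f k)) then 1 else -1.
pose alpha' (j : 'I_n) := u * alpha j.
have edge' j : edge alpha' j = u * edge alpha j by rewrite /edge mulrBr.
have eE (k : 'I_n) : edge alpha' (f k) = (c k)%:~R * cis (k%:R * pi / n%:R).
  rewrite edge' -uB -fE /c /iota_half; case: ifP => _; first by rewrite mul1r.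
  by rewrite mulrN1z mulN1r mulrN opprK.
have finj : injective f.
  move=> k l kl; have : cis (k%:R * pi / n%:R) = cis (l%:R * pi / n%:R) :> R[i].
    by rewrite -!uB -!fE kl.
  move=> /(congr1 arg); rewrite !unit_angle_arg // => E.
  have n00 : n%:R^-1 != 0 :> R by rewrite invr_eq0 pnatr_eq0 -lt0n.
  move/(mulIf n00)/(mulIf (negbT (gt_eqF (pi_gt0 R)))): E => /eqP.
  by rewrite eqr_nat => /eqP /val_inj.
exists c, alpha'; split.
- split; first by move=> j; rewrite /c; case: ifP => _; [right | left].
  rewrite -[RHS](sum_edge alpha') [RHS](reindex_inj finj) /=.
  by apply: eq_bigr => k _; rewrite eE.
- by apply: Theta_scale => //; rewrite invr_gt0.
- apply/seteqP; split => z [j _ <-].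
    have [g _ gK] := injF_bij finj; exists (g j) => //.
    by rewrite -eE gK.
  by exists (f j).
- exact: polygon_scale.
Qed.

End Main.

Unset Implicit Arguments.

Theorem theorem6 (R : realType) (n : nat) (n_ge2 : (2 <= n)%N)
    (n_not_pow2 : ~ exists k : nat, n = (2 ^ k)%N) :
  [/\ (exists alpha : 'I_n -> R[i],
         Theta R n alpha /\ delta (Xpoly alpha) = nu n) /\
      (forall alpha : 'I_n -> R[i],
         Theta R n alpha -> nu n <= delta (Xpoly alpha)),
      (exists B : seq R[i], regular_bundle n B) /\
      (forall B : seq R[i], regular_bundle n B -> delta (Xbundle B) = nu n),
      forall alpha : 'I_n -> R[i], Theta R n alpha ->
        (minimizer alpha <-> regular_bundle n (asymmetrization alpha)) &
      forall alpha : 'I_n -> R[i], Theta R n alpha ->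
        (minimizer alpha <->
         exists (c : 'I_n -> int) (alpha' : 'I_n -> R[i]),
           [/\ Psigns R n c, Theta R n alpha',
               [set edge alpha' j | j in [set: 'I_n]] =
               [set (c j)%:~R * cis (j%:R * pi / n%:R) | j in [set: 'I_n]] &
               similar (polygon alpha) (polygon alpha')])].
Proof.
have n0 : (0 < n)%N := ltnW n_ge2.
have lower alpha : Theta R n alpha -> nu n <= delta (Xpoly alpha).
  move=> [_ inj _]; rewrite Xpoly_asymmetrization //; apply: delta_bundle_ge.
    exact: size_asymmetrization.
  exact: asymmetrization_bundle.
have attained := optimal_polygon R n_ge2 n_not_pow2.
have minE alpha : Theta R n alpha -> minimizer alpha <-> delta (Xpoly alpha) = nu n.
  move=> T; split=> [[_ H]|E]; last by split=> // a' T'; rewrite E; exact: lower.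
  have [a0 [T0 E0]] := attained; apply/eqP; rewrite eq_le lower // andbT -E0; exact: H.
have regE alpha : Theta R n alpha ->
    delta (Xpoly alpha) = nu n <-> regular_bundle n (asymmetrization alpha).
  move=> [_ inj _]; rewrite Xpoly_asymmetrization //; split; last exact: regular_delta.
  apply: delta_bundle_eq => //; first exact: size_asymmetrization.
  exact: asymmetrization_bundle.
split.
- by split.
- split; first by exists (unit_bundle R n); exact: unit_bundle_regular.
  by move=> B; exact: regular_delta.
- by move=> alpha T; rewrite minE // regE.
- move=> alpha T; rewrite minE //; split.
    by rewrite regE //; exact: regular_sign_edges.
  move=> [c [alpha' [[c1 _] T' E sim]]].
  have [a [e [s [a0 e1 XE]]]] := Xpoly_similar T T' sim.
  have [_ inj _] := T.
  have /andP[sz _] := size_asymmetrization alpha n_ge2.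
  have [p0 _ _ _] := bundle_shadowP sz (asymmetrization_bundle n_ge2 inj).
  have XS := Xpoly_asymmetrization n_ge2 inj; rewrite Xbundle_shadow in XS.
  rewrite -(@delta_isometry R (Xpoly alpha) a e s) //.
  - rewrite -XE (sign_edges_Xpoly c1 E); apply: regular_delta => //.
    exact: unit_bundle_regular.
  - by rewrite XS; exact: continuous_shadow.
  - by rewrite XS => x; exact: shadow_ge0.
  - move=> x; have -> : x + 2 * pi = x + pi + pi by ring.
    by rewrite XS !shadow_pi.
Qed.
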